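(* (i) For every recursively enumerable set $A\subseteq\mathbb{N}=\{0,1,2,\ldots\}$ there is an exponential diophantine equation $F(x,x_1,\ldots,x_8)=0$ such that for every $a\in\mathbb{N}$: $a\in A$ if and only if $F(a,x_1,\ldots,x_8)=0$ for some $x_1,\ldots,x_8\in\mathbb{Q}$. (ii) There is no algorithm which, given an arbitrary exponential diophantine equation $F(x_1,\ldots,x_8)=0$ in eight unknowns, decides whether it has a solution $(x_1,\ldots,x_8)\in\mathbb{Q}^8$.
   Context: An exponential diophantine equation is an equation of the form $F_1(x_1,\ldots,x_n)-F_2(x_1,\ldots,x_n)=0$, where $F_1,F_2$ are expressions built from the variables and particular natural numbers using addition, multiplication and exponentiation; $0^0$ is regarded as $1$. When such equations are considered over $\mathbb{Q}$, the exponential $x^y$ is used only for $x\ge 0$ and $y\ge 0$ (so it is the real number $x^y$); a rational tuple is a solution if every exponentiation occurring in the evaluation has nonnegative base and nonnegative exponent and the resulting real-valued equation holds. *)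

(* Defs.v *)
From HB Require Import structures.
From mathcomp Require Import all_boot all_order all_algebra.
From mathcomp Require Import zify.
From mathcomp Require Import all_classical all_reals all_analysis.

Set Implicit Arguments.
Unset Strict Implicit.
Unset Printing Implicit Defensive.

Import Order.TTheory GRing.Theory Num.Theory.

(* Partial recursive functions, by arity. In [Prec f g] the recursion variable
   comes first: h(0, v) = f(v) and h(k+1, v) = g(k, h(k, v), v). In [Mu f] the
   minimised variable comes first. *)
Inductive prf : nat -> Type :=
| Zero n : prf n
| Succ : prf 1
| Proj n : 'I_n -> prf n
| Comp m n : prf m -> ('I_m -> prf n) -> prf n
| Prec n : prf n -> prf n.+2 -> prf n.+1
| Mu n : prf n.+1 -> prf n.

(* [computes f v y]: f is defined at v, with value y. *)
Fixpoint computes n (f : prf n) : n.-tuple nat -> nat -> Prop :=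
  match f in prf n return n.-tuple nat -> nat -> Prop with
  | Zero _ => fun _ y => y = 0
  | Succ => fun v y => y = (thead v).+1
  | Proj _ i => fun v y => y = tnth v i
  | Comp m _ f g => fun v y =>
      exists w : m.-tuple nat,
        (forall i, computes (g i) v (tnth w i)) /\ computes f w y
  | Prec _ f g => fun v y =>
      let u := behead_tuple v in
      (fix rec k y : Prop :=
         if k is k'.+1
         then exists z, rec k' z /\ computes g [tuple of k' :: z :: u] y
         else computes f u y) (thead v) y
  | Mu _ f => fun v y =>
      computes f [tuple of y :: v] 0 /\
      forall z, z < y -> exists t, computes f [tuple of z :: v] t.+1
  end.

Definition recursively_enumerable (A : set nat) : Prop :=
  exists f : prf 1, forall a, A a <-> exists y, computes f [tuple a] y.

Inductive exp_expr (n : nat) : Type :=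
| Var of 'I_n
| Const of nat
| Add of exp_expr n & exp_expr n
| Mul of exp_expr n & exp_expr n
| Pow of exp_expr n & exp_expr n.

Arguments Const {n} _.

(* (F1, F2) stands for F1 - F2 = 0. *)
Definition exp_equation (n : nat) : Type := (exp_expr n * exp_expr n)%type.

Section Solutions.
Local Open Scope ring_scope.
Variables (R : realType) (n : nat) (x : n.-tuple rat).

(* [powR] agrees with the real power on a >= 0, y >= 0, with 0 `^ 0 = 1. *)
Fixpoint exp_eval (e : exp_expr n) : R :=
  match e with
  | Var i => ratr (tnth x i)
  | Const k => k%:R
  | Add a b => exp_eval a + exp_eval b
  | Mul a b => exp_eval a * exp_eval b
  | Pow a b => exp_eval a `^ exp_eval b
  end.

Fixpoint exp_admissible (e : exp_expr n) : bool :=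
  match e with
  | Var _ | Const _ => true
  | Add a b | Mul a b => exp_admissible a && exp_admissible b
  | Pow a b => [&& exp_admissible a, exp_admissible b,
                   0 <= exp_eval a & 0 <= exp_eval b]
  end.

Definition is_solution (E : exp_equation n) : Prop :=
  [/\ exp_admissible E.1, exp_admissible E.2
    & exp_eval E.1 - exp_eval E.2 = 0].

End Solutions.

Definition solvable_over_rat (R : realType) n (E : exp_equation n) : Prop :=
  exists x : n.-tuple rat, is_solution R x E.

(* Gödel numbering of equations, through the Cantor pairing function. *)
Definition cantor_pair (a b : nat) : nat := ((a + b) * (a + b).+1)./2 + b.

Fixpoint code_expr n (e : exp_expr n) : nat :=
  match e with
  | Var i => cantor_pair 0 i
  | Const k => cantor_pair 1 k
  | Add a b => cantor_pair 2 (cantor_pair (code_expr a) (code_expr b))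
  | Mul a b => cantor_pair 3 (cantor_pair (code_expr a) (code_expr b))
  | Pow a b => cantor_pair 4 (cantor_pair (code_expr a) (code_expr b))
  end.

Definition code_equation n (E : exp_equation n) : nat :=
  cantor_pair (code_expr E.1) (code_expr E.2).

Lemma cantor_pair_inj a b c d :
  cantor_pair a b = cantor_pair c d -> a = c /\ b = d.
Proof.
have tri s : (s.+1 * s.+2)./2 = (s * s.+1)./2 + s.+1.
  have -> : s.+1 * s.+2 = s * s.+1 + s.+1.*2 by rewrite -mul2n; lia.
  by rewrite halfD oddM odd_double /= andbF add0n doubleK.
have mono s t : s <= t -> (s * s.+1)./2 <= (t * t.+1)./2.
  by move=> st; apply: half_leq; apply: leq_mul.
have lt_diag p q r s : p + q < r + s -> cantor_pair p q < cantor_pair r s.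
  by move=> /mono; rewrite /cantor_pair tri; lia.
move=> e; case: (ltngtP (a + b) (c + d)) => [/lt_diag|/lt_diag|s].
- by rewrite e ltnn.
- by rewrite e ltnn.
by move: e; rewrite /cantor_pair s; lia.
Qed.

Lemma code_expr_inj n : injective (@code_expr n).
Proof.
elim=> [i|k|a IHa b IHb|a IHa b IHb|a IHa b IHb] [j|l|c d|c d|c d] /=
  /cantor_pair_inj [] // _.
- by move=> /val_inj ->.
- by move=> ->.
all: by case/cantor_pair_inj => /IHa -> /IHb ->.
Qed.

Lemma code_equation_inj n : injective (@code_equation n).
Proof.
by move=> [a b] [c d] /cantor_pair_inj [/code_expr_inj /= -> /code_expr_inj /= ->].
Qed.

(* Main.v *)
Require Import Defs.
From mathcomp Require Import all_boot all_order all_algebra.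
From mathcomp Require Import zify ring lra.
From mathcomp Require Import all_classical all_reals all_analysis.

(* A partial recursive function f is turned into a nondeterministic register
   program that guesses a value y, verifies [computes f (a) y] and halts; the
   program is flattened into a finite automaton whose transitions act on counters.
   A run of T + 1 steps is a table of numbers (one row per step) subject to linear
   equations between consecutive rows. Reading the table as the digits of a single
   number W, each family of equations becomes one condition "every binary digit of r
   is at most the corresponding digit of s", with r and s explicit exponential
   polynomials in a, the length T, a field width u, the geometric sum I and W. By
   Lucas' theorem this condition says that binomial(s, r) is odd, and all of them
   can be glued into a single one. Finally binomial(s, r) is odd iff, with
   U = 2^(s+1), the integer part of (1 + U)^s / U^r is odd, that is, iff
   (1 + U)^s / U^r = 2 h + 1 + z / (1 + z) for a natural h and a rational z >= 0.

   Seven rational unknowns T, u, I, W, h, z, w suffice: u + 2 = 2^(T + N + a) with u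
   rational forces T to be an integer, 2^W * 3^h = w with w rational does the same
   for W and h, and I is then determined. The eighth unknown is free to hold the
   parameter, so that the instance E(c) of an equation E has a code which is an
   explicit arithmetic function of c and of the code of E, and a decision procedure
   is refuted by the diagonal argument without substituting into codes. *)

Set Implicit Arguments.
Unset Strict Implicit.
Unset Printing Implicit Defensive.

Import Order.TTheory GRing.Theory Num.Theory.

(** * Binary masks and Lucas' theorem *)

(** By Lucas' theorem modulo 2 this is the digitwise order: no binary digit of [r] exceeds the digit
    of [s] in the same place. *)
Definition mask r s := odd 'C(s, r).

(** Lucas' theorem for the last binary digit. Pascal's rule applied twice expresses row [2 * s + 2]
    through row [2 * s], and entries in odd columns vanish modulo 2, so both parts go through one
    induction. *)
Lemma odd_bin_double s r :
  (odd 'C(s.*2, r.*2) = odd 'C(s, r)) /\ odd 'C(s.*2, r.*2.+1) = false.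
Proof.
elim: s r => [|s IH] r; first by case: r => [|r]; rewrite ?bin0n.
case: r => [|r].
  by rewrite double0 !bin0 bin1 odd_double.
have [e1 o1] := IH r; have [e2 o2] := IH r.+1.
rewrite !doubleS !binS !oddD in e1 o1 e2 o2 *.
by rewrite e2 o2 e1 o1; do 2!case: (odd _) => //.
Qed.

Lemma mask_bit (i j : bool) r s :
  mask (j + r.*2) (i + s.*2) = (j ==> i) && mask r s.
Proof.
have [e o] := odd_bin_double s r.
case: i; case: j; rewrite /mask ?add0n ?add1n //=.
  by rewrite binS oddD e o.
by case: r e o => [|r] e o; rewrite ?bin0 // doubleS binS oddD -doubleS e
  (odd_bin_double s r).2 addbF.
Qed.

(** The order is digitwise, so it splits at any place [d]; the induction peels one binary digit off
    both low parts. This serves to read packed tables and also to glue conditions together. *)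
Lemma mask_cat d r r' s s' : r < 2 ^ d -> s < 2 ^ d ->
  mask (r + 2 ^ d * r') (s + 2 ^ d * s') = mask r s && mask r' s'.
Proof.
elim: d r s => [|d IH] r s.
  by rewrite expn0 !ltnS !leqn0 => /eqP -> /eqP ->; rewrite !mul1n.
rewrite expnS => lr ls.
have split_bit t t' : t + 2 * 2 ^ d * t' = odd t + (t./2 + 2 ^ d * t').*2.
  by rewrite doubleD addnA odd_double_half -!mul2n mulnA.
rewrite !split_bit mask_bit IH; [|lia|lia].
by rewrite -{3}(odd_double_half r) -{3}(odd_double_half s) mask_bit andbA.
Qed.

Lemma mask0 s : mask 0 s.
Proof. by rewrite /mask bin0. Qed.

Lemma mask1 s : mask 1 s = odd s.
Proof. by rewrite /mask bin1. Qed.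

Lemma mask_leq r s : mask r s -> r <= s.
Proof. by rewrite /mask => h; rewrite -bin_gt0; case: 'C(_, _) h. Qed.

Lemma mask_ones e r : mask r (2 ^ e).-1 = (r < 2 ^ e).
Proof.
apply/idP/idP => [/mask_leq|]; first by have := expn_gt0 2 e; lia.
elim: e r => [|e IH] r; first by rewrite expn0; case: r.
rewrite expnS => lr.
have -> : (2 * 2 ^ e).-1 = true + (2 ^ e).-1.*2 by have := expn_gt0 2 e; lia.
by rewrite -(odd_double_half r) mask_bit implybT; apply: IH; lia.
Qed.

(** An equality expressed as a mask: the [e] low digits of [s] must be ones, and the bound excludes
    any higher digit, because [2 ^ e + (2 ^ e).-1] is already [(2 ^ e).*2.-1]. *)
Lemma ones_mask e s : s < (2 ^ e).*2.-1 -> mask (2 ^ e).-1 s = (s == (2 ^ e).-1).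
Proof.
move=> ls; have e0 := expn_gt0 2 e; apply/idP/eqP => [m|->]; last first.
  by rewrite mask_ones; lia.
have es : s = s %% 2 ^ e + 2 ^ e * (s %/ 2 ^ e) by rewrite addnC mulnC -divn_eq.
have lm := ltn_pmod s e0.
move: m; rewrite {1}es -{1}[(2 ^ e).-1]addn0 -{2}(muln0 (2 ^ e)) mask_cat //; last lia.
by case/andP=> /mask_leq l _; move: ls lm l es; case: (s %/ 2 ^ e) => [|q]; nia.
Qed.

(** * Numbers as words of digits in base [2 ^ d] *)

Section Num.
Variable d : nat.
Definition num (P : nat) (w : nat -> nat) := \sum_(p < P) w p * 2 ^ (d * p).

Lemma numS P w : num P.+1 w = w 0 + 2 ^ d * num P (w \o S).
Proof.
rewrite /num big_ord_recl muln0 muln1 big_distrr; congr (_ + _).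
by apply: eq_bigr => i _ /=; rewrite /bump add1n mulnS expnD mulnCA.
Qed.

Lemma eq_num P w w' : (forall p, p < P -> w p = w' p) -> num P w = num P w'.
Proof. by move=> e; apply: eq_bigr => i _; rewrite e. Qed.

Lemma mask_num P w w' :
  (forall p, p < P -> w p < 2 ^ d) -> (forall p, p < P -> w' p < 2 ^ d) ->
  mask (num P w) (num P w') <-> forall p, p < P -> mask (w p) (w' p).
Proof.
elim: P w w' => [|P IH] w w' lw lw'; first by rewrite /num !big_ord0 mask0.
rewrite !numS mask_cat ?lw ?lw' //.
split=> [/andP[m0 /IH m] [//|p] lp|m].
  by apply: m => // q lq; rewrite ?lw ?lw'.
apply/andP; split; first exact: m.
by apply/IH => [p lp|p lp|p lp]; rewrite ?lw ?lw' ?m.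
Qed.

Lemma num_surj P W : W < 2 ^ (d * P) -> exists2 w, W = num P w & forall p, w p < 2 ^ d.
Proof.
elim: P W => [|P IH] W lW.
  exists (fun=> 0) => [|p]; last by rewrite expn_gt0.
  by move: lW; rewrite /num big_ord0 muln0 expn0; case: W.
have d0 : 0 < 2 ^ d by rewrite expn_gt0.
have [|w eW lw] := IH (W %/ 2 ^ d).
  by rewrite ltn_divLR // -expnD -mulnSr.
exists (fun p => if p is p'.+1 then w p' else W %% 2 ^ d) => [|[|p]] //.
  by rewrite numS /comp -eW addnC mulnC -divn_eq.
by rewrite ltn_mod.
Qed.

Lemma numD P w w' : num P w + num P w' = num P (fun p => w p + w' p).
Proof. by rewrite /num -big_split; apply: eq_bigr => i _ /=; rewrite mulnDl. Qed.

Lemma numZ P c w : c * num P w = num P (fun p => c * w p).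
Proof. by rewrite /num big_distrr; apply: eq_bigr => i _ /=; rewrite mulnA. Qed.

Lemma num_sum P n (w : nat -> nat -> nat) :
  \sum_(f < n) num P (w f) = num P (fun p => \sum_(f < n) w f p).
Proof. by rewrite /num exchange_big; apply: eq_bigr => i _ /=; rewrite big_distrl. Qed.

Definition shift e (w : nat -> nat) p := if p < e then 0 else w (p - e).

(** The hypothesis makes every digit from place [P - e] on zero, so the multiplication pushes
    nothing out of the window of [P] digits. *)
Lemma num_shift P e w : (forall p, P <= p + e -> w p = 0) ->
  2 ^ (d * e) * num P w = num P (shift e w).
Proof.
move=> w0; case: (leqP e P) => [le|lt]; last first.
  rewrite {1}/num big1 ?muln0; last by move=> i _; rewrite w0 //; lia.
  rewrite /num big1 // => i _; rewrite /shift ifT //; exact: ltn_trans lt.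
rewrite /num -!(big_mkord xpredT (fun p => _ p * 2 ^ (d * p))).
rewrite (big_cat_nat (n := P - e)) //=; last by rewrite leq_subr.
rewrite [X in _ + X]big1_seq; last first.
  by move=> i /andP[_]; rewrite mem_index_iota => /andP[? ?]; rewrite w0 ?mul0n //; lia.
rewrite [RHS](big_cat_nat (n := e)) //= [X in _ = X + _]big1_seq; last first.
  by move=> i /andP[_]; rewrite mem_index_iota => /andP[? ?]; rewrite /shift ifT.
rewrite addn0 add0n; have := big_addn 0 P e xpredT (fun p => shift e w p * 2 ^ (d * p)).
rewrite add0n => ->; rewrite big_distrr; apply: eq_bigr => i _ /=.
by rewrite /shift ltnNge leq_addl addnK mulnDr expnD mulnCA (mulnC (2 ^ (d * e))).
Qed.

Lemma num_le P P' w : P' <= P -> (forall p, P' <= p -> w p = 0) -> num P' w = num P w.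
Proof.
move=> le w0; rewrite /num -!(big_mkord xpredT (fun p => _ p * 2 ^ (d * p))).
rewrite [RHS](big_cat_nat (n := P')) //= [X in _ = _ + X]big1_seq ?addn0 //.
by move=> i /andP[_]; rewrite mem_index_iota => /andP[? ?]; rewrite w0.
Qed.

End Num.

(** * Digit tables *)

Lemma num_delta d P q : q < P -> num d P (fun p => p == q : nat) = 2 ^ (d * q).
Proof.
move=> lq; rewrite /num (bigD1 (Ordinal lq)) //= eqxx mul1n big1 ?addn0 // => i ne.
by rewrite (negbTE (_ : i != q :> nat)).
Qed.

(** The equation is [(B - 1) * a = X - 1] without subtraction; for [X = B ^ T.+1] its solution is
    the geometric sum of the powers of [B] up to [B ^ T]. *)
Lemma geom_uniq B X a c : 1 < B -> a * B + 1 = X + a -> c * B + 1 = X + c -> a = c.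
Proof.
case: B => [|[|B]] // _; rewrite !(mulnSr _ B.+1) => ha hc.
have /eqP : a * B.+1 = c * B.+1 by lia.
by rewrite eqn_pmul2r // => /eqP.
Qed.

Lemma geom_exists B T : exists I, I * B + 1 = B ^ T.+1 + I.
Proof.
elim: T => [|t [I hI]]; first by exists 1; rewrite mul1n expn1.
by exists (I * B + 1); rewrite {1}hI mulnDl -expnSr addnA.
Qed.

(** A row of zeros stands before row 0; initial data enter an equation through its term for
    [t == 0]. *)
Definition prev (x : nat -> nat -> nat) t f := if t is t'.+1 then x t' f else 0.

Section Pack.
Variables (n kappa e T h : nat) (b : nat -> nat) (al be : nat -> nat -> nat).
Variables (ga r : nat -> nat).
(** Table entries stay below [2 ^ e] and linear forms in them below [F]. The base [2 ^ d = 2 * F]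
    leaves a spare bit, so that adding two numbers below [F] causes no carry. The window [P] holds
    [T + 1] rows of [n] digits and leaves room for shifts by up to two rows. *)
Let d := (3 * e).+1.
Let F := 2 ^ (3 * e).
Let P := n * T.+4.
Hypothesis h_lt : h < n.
Hypothesis b_lt : forall f, b f < 2 ^ e.
Hypothesis b_mask : forall f v, mask v (b f) = (v <= b f).
Hypothesis lin_lt : forall k, k < kappa ->
  (\sum_(f < n) (al k f + be k f)) * 2 ^ e + ga k < F.
Hypothesis r_lt : forall k, k < kappa -> r k < F.

Definition run_sys (x : nat -> nat -> nat) :=
  [/\ forall t f, t <= T -> f < n -> x t f <= b f,
      forall k t, k < kappa -> t <= T ->
        \sum_(f < n) al k f * x t f + \sum_(f < n) be k f * prev x t f
          + (t == 0) * ga k = r k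
    & odd (x T h)].

(** A multiplier that aligns fields: in [W * coef_word k], field [f] of row [t] and field [f] of row
    [t - 1] both move to place [n * (t + 1)], where the linear form of equation [k] at row [t]
    appears as a digit. *)
Definition coef_word k :=
  \sum_(f < n) (al k f * 2 ^ (d * (n - f)) + be k f * 2 ^ (d * (n + n - f))).

(** The first mask bounds all entries and makes [W] vanish after row [T]. In the second, adding the
    complement [F.-1 - r k] turns the equation with right side [r k] into equality with [F.-1], a
    word of ones, demanded only at the places [n * (t + 1)]. The third reads the lowest bit of field
    [h] in row [T]. *)
Definition run_masks (I W : nat) :=
  [/\ mask W (I * \sum_(f < n) b f * 2 ^ (d * f)),
      forall k, k < kappa ->
        mask (F.-1 * (2 ^ (d * n) * I))
             (W * coef_word k + (F.-1 - r k) * (2 ^ (d * n) * I) + ga k * 2 ^ (d * n))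
    & mask (2 ^ (d * (n * T + h))) W].

Let n_gt0 : 0 < n := leq_ltn_trans (leq0n h) h_lt.

Let ind p : nat := (n %| p) && (p <= n * T).

Lemma ind_big p : P <= p + n -> ind p = 0.
Proof.
rewrite /P !mulnS /ind => lp; rewrite leqNgt (_ : n * T < p) ?andbF //.
by have := n_gt0; lia.
Qed.

(** The number with digit 1 at the start of each row up to [T] solves the same equation: shifting it
    by one row removes the digit at place 0 and adds one at [n * T.+1]. Uniqueness concludes. *)
Lemma geom_num I : I * 2 ^ (d * n) + 1 = (2 ^ (d * n)) ^ T.+1 + I -> I = num d P ind.
Proof.
move=> eI.
have e' : num d P ind * 2 ^ (d * n) + 1 = (2 ^ (d * n)) ^ T.+1 + num d P ind.
  rewrite mulnC num_shift; last exact: ind_big.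
  have {1}-> : 1 = num d P (fun p => p == 0 : nat) by rewrite num_delta ?muln0 // /P; nia.
  rewrite -expnM -mulnA. rewrite -(@num_delta d P (n * T.+1)); last by rewrite /P; nia.
  rewrite !numD; apply: eq_num => p lp; rewrite /shift /ind.
  case: (ltnP p n) => [lpn|lnp].
    have -> : (p == n * T.+1) = false by apply/eqP; nia.
    case: (posnP p) => [->|p0]; first by rewrite dvdn0.
    by rewrite gtnNdvd.
  have -> : (p == 0) = false by apply/eqP; lia.
  rewrite dvdn_subl //; case dv: (n %| p); rewrite /= ?addn0.
    case/dvdnP: dv lp lnp => q -> _ _.
    rewrite leq_subLR -mulnS mulnC !leq_pmul2l // eqn_pmul2l //.
    by case: (ltngtP q T.+1); case: leqP; lia.
  by case: eqP dv => // ->; rewrite dvdn_mulr.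
have B1 : 1 < 2 ^ (d * n) by rewrite -{1}(expn0 2) ltn_exp2l // muln_gt0 n_gt0.
exact: (geom_uniq B1 eI e').
Qed.

Let pat p := if p < n * T.+1 then b (p %% n) else 0.

(** No two products meet in one place: place [p] is reached from a row start only by the field
    [p %% n]. *)
Lemma pat_num I : I = num d P ind -> I * \sum_(f < n) b f * 2 ^ (d * f) = num d P pat.
Proof.
move=> ->; rewrite big_distrr /=.
under eq_bigr => f _.
  rewrite mulnC -mulnA num_shift; last first.
    by move=> p lp; apply: ind_big; have := ltn_ord f; lia.
  rewrite numZ; over.
rewrite (num_sum d P n (fun f p => b f * shift f ind p)); apply: eq_num => p lp.
have lm : p %% n < n by rewrite ltn_mod.
rewrite (bigD1 (Ordinal lm)) //= big1 => [|f ne]; rewrite ?addn0.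
  rewrite /shift ltnNge leq_mod /= /ind /pat.
  have -> : n %| p - p %% n by rewrite {1}(divn_eq p n) addnK dvdn_mull.
  rewrite /= {2}(divn_eq p n) addnK [X in p < X]mulnC -ltn_divLR //.
  by rewrite ltnS [X in X <= _]mulnC leq_pmul2l //; case: leqP => _; rewrite /= ?muln1 ?muln0.
rewrite /shift; case: (ltnP p f) => [|lf]; first by rewrite muln0.
rewrite /ind; case: (boolP (n %| p - f)) => [dv|]; rewrite ?muln0 //.
case/eqP: ne; apply: val_inj => /=.
by rewrite -(subnK lf) -modnDml (eqP dv) add0n modn_small.
Qed.

Section Word.
Variable w : nat -> nat.
Hypothesis w0 : forall p, n * T.+1 <= p -> w p = 0.
Hypothesis w_lt : forall p, w p < 2 ^ e.
Let x t f := w (n * t + f).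
Let lin k p := \sum_(f < n) (al k f * shift (n - f) w p + be k f * shift (n + n - f) w p).

Lemma coef_word_num k : num d P w * coef_word k = num d P (lin k).
Proof.
rewrite /coef_word big_distrr /=.
under eq_bigr => f _.
  rewrite mulnDr ![num _ _ _ * _]mulnC -!mulnA !num_shift; first last.
  - by move=> p; have := ltn_ord f; rewrite /P => lf lp; rewrite w0 //; nia.
  - by move=> p; have := ltn_ord f; rewrite /P => lf lp; rewrite w0 //; nia.
  rewrite !numZ numD; over.
exact: (num_sum d P n (fun f p =>
  al k f * shift (n - f) w p + be k f * shift (n + n - f) w p)).
Qed.

(** The bound covers all places, including those between row starts, whose digits carry no
    information but must not produce carries. *)
Lemma lin_le k p : k < kappa -> lin k p + ga k < F.
Proof.
move=> lk; apply: leq_ltn_trans (lin_lt lk); rewrite leq_add2r big_distrl /=.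
apply: leq_sum => f _; rewrite mulnDl.
have sw q : shift q w p <= 2 ^ e by rewrite /shift; case: ifP => // _; apply: ltnW.
by apply: leq_add; rewrite leq_mul2l sw orbT.
Qed.

Lemma lin_row k t : lin k (n * t.+1) =
  \sum_(f < n) al k f * x t f + \sum_(f < n) be k f * prev x t f.
Proof.
rewrite -big_split /=; apply: eq_bigr => f _; have lf := ltn_ord f.
have nt : n * t.+1 = n * t + n by rewrite mulnS addnC.
congr (_ * _ + _ * _).
  by rewrite /shift ifF /x; [congr w; lia | lia].
rewrite /shift /prev; case: t nt => [|t] nt; first by rewrite ifT //; lia.
by rewrite ifF /x; [congr w|]; move: nt; rewrite !mulnS; lia.
Qed.

Let indn : nat -> nat := shift n ind.

Lemma indnE p : indn p = (n %| p) && (0 < p) && (p <= n * T.+1).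
Proof.
rewrite /indn /shift /ind; case: ltnP => lp.
  by case: (posnP p) => p0; rewrite ?andbF ?andbT ?gtnNdvd.
have -> : 0 < p by lia.
by rewrite dvdn_subl // andbT; congr (nat_of_bool (_ && _)); rewrite leq_subLR mulnS.
Qed.

(** All digits of the right-hand word stay below [2 * F = 2 ^ d], so the mask can be read digit by
    digit. At the places [n * t.+1] it is an equality by [ones_mask]; elsewhere the left digit is
    0. *)
Lemma eq_maskP k I : k < kappa -> I = num d P ind ->
  mask (F.-1 * (2 ^ (d * n) * I))
       (num d P w * coef_word k + (F.-1 - r k) * (2 ^ (d * n) * I) + ga k * 2 ^ (d * n))
  <-> forall t, t <= T ->
    \sum_(f < n) al k f * x t f + \sum_(f < n) be k f * prev x t f + (t == 0) * ga k = r k.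
Proof.
move=> lk ->; have F0 : 0 < F by rewrite expn_gt0.
rewrite num_shift; last exact: ind_big.
rewrite -/indn coef_word_num -(@num_delta d P n); last by rewrite /P; nia.
rewrite !numZ !numD.
have dF : 2 ^ d = F.*2 by rewrite /d expnS mul2n.
rewrite mask_num; first last.
- move=> p _; have := lin_le p lk; have := r_lt lk; rewrite dF.
  by have : indn p <= 1 by [rewrite indnE; case: (_ && _)]; case: (p == n); nia.
- move=> p _; rewrite dF.
  by have : indn p <= 1 by [rewrite indnE; case: (_ && _)]; nia.
have key t : mask F.-1 (lin k (n * t.+1) + (F.-1 - r k) + ga k * (n * t.+1 == n)) <->
    \sum_(f < n) al k f * x t f + \sum_(f < n) be k f * prev x t f + (t == 0) * ga k = r k.
  have -> : (n * t.+1 == n) = (t == 0) by rewrite -{2}(muln1 n) eqn_pmul2l.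
  have := lin_le (n * t.+1) lk; have := r_lt lk; rewrite lin_row => lr ll.
  rewrite ones_mask -/F; last by case: (t == 0) ll; lia.
  by split=> [/eqP|e']; [|apply/eqP; move: e']; case: (t == 0); lia.
split=> [m t lt|eqs p lp].
  apply/key; have := m (n * t.+1).
  rewrite indnE dvdn_mulr //= muln_gt0 n_gt0 (leq_pmul2l n_gt0) !ltnS lt !muln1; apply.
  by rewrite /P ltn_pmul2l //; lia.
rewrite indnE.
case: (boolP (_ && _ && _)) => [/andP[/andP[/dvdnP[q ->] q0] lq]|_]; last first.
  by rewrite muln0 mask0.
rewrite !muln1; case: q q0 lq => [|t] // _; rewrite mulnC leq_pmul2l // ltnS => lt.
exact/key/eqs.
Qed.

Lemma last_maskP : mask (2 ^ (d * (n * T + h))) (num d P w) = odd (x T h).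
Proof.
have lP : n * T + h < P by rewrite /P; nia.
rewrite -(num_delta d lP); apply/idP/idP.
  rewrite mask_num => [/(_ _ lP)|p _|p _].
  - by rewrite eqxx mask1.
  - by rewrite (@leq_ltn_trans 1) // ?leq_b1 // -(expn0 2) ltn_exp2l.
  - by rewrite (leq_trans (w_lt p)) // leq_exp2l // /d; lia.
move=> o; rewrite mask_num => [p _|p _|p _].
- by case: eqP => [->|_]; rewrite ?mask0 // mask1.
- by rewrite (@leq_ltn_trans 1) // ?leq_b1 // -(expn0 2) ltn_exp2l.
- by rewrite (leq_trans (w_lt p)) // leq_exp2l // /d; lia.
Qed.
End Word.

Theorem packP I : I * 2 ^ (d * n) + 1 = (2 ^ (d * n)) ^ T.+1 + I ->
  (exists x, run_sys x) <-> exists W, run_masks I W.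
Proof.
move=> /geom_num eI.
have pat_lt p : pat p < 2 ^ d.
  rewrite /pat; case: ifP; rewrite ?expn_gt0 // => _.
  by apply: leq_trans (b_lt _) _; rewrite leq_exp2l // /d; lia.
split=> [[x [xb xe xh]]|[W [Wb We Wh]]].
  pose w p := if p < n * T.+1 then x (p %/ n) (p %% n) else 0.
  have w0 p : n * T.+1 <= p -> w p = 0 by rewrite /w ltnNge => ->.
  have wb p : w p <= pat p.
    rewrite /w /pat; case: ifP => // lp; apply: xb; last by rewrite ltn_mod.
    by rewrite -ltnS ltn_divLR // mulnC.
  have we p : w p < 2 ^ e.
    by apply: leq_ltn_trans (wb p) _; rewrite /pat; case: ifP; rewrite ?expn_gt0.
  have wx t f : t <= T -> f < n -> w (n * t + f) = x t f.
    move=> lt lf; rewrite /w ifT; last by nia.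
    by rewrite mulnC divnMDl // divn_small // addn0 modnMDl modn_small.
  exists (num d P w); split; last first.
  - by rewrite last_maskP // wx.
  - move=> k lk; apply/eq_maskP => // t lt; rewrite -(xe k t lk lt).
    congr (_ + _ + _); apply: eq_bigr => f _; rewrite ?wx //.
    by case: t lt => [|t] lt //=; rewrite wx // ltnW.
  - rewrite (pat_num eI) mask_num // => p _.
      rewrite /w /pat; case: ifP => // lp; rewrite b_mask; apply: xb; last by rewrite ltn_mod.
      by rewrite -ltnS ltn_divLR // mulnC.
    by rewrite (leq_trans (we p)) // leq_exp2l // /d; lia.
(* The first mask gives [W <= num d P pat], so this bound lets [W] be written with [P] digits. *)
have patP : num d P pat < 2 ^ (d * P).
  elim: (P) (pat) pat_lt => [|Q IH] v v_lt; first by rewrite /num big_ord0 expn_gt0.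
  by rewrite numS mulnS expnD; have := IH (v \o S) (fun p => v_lt p.+1); have := v_lt 0; nia.
rewrite (pat_num eI) in Wb.
have [w eW wd] := num_surj (leq_ltn_trans (mask_leq Wb) patP).
(* Digits beyond the window are cut off, since the lemmas on words ask for bounds at every place. *)
pose v p := if p < P then w p else 0.
have ev : W = num d P v by rewrite eW; apply: eq_num => p lp; rewrite /v lp.
have vd p : v p < 2 ^ d by rewrite /v; case: ifP; rewrite ?expn_gt0.
rewrite ev mask_num // in Wb.
have v0 p : n * T.+1 <= p -> v p = 0.
  move=> lp; case: (ltnP p P) => pP; last by rewrite /v ltnNge pP.
  by have := mask_leq (Wb p pP); rewrite /pat ltnNge lp /= leqn0 => /eqP.
have vpat p : v p <= pat p.
  case: (ltnP p P) => pP; first exact: mask_leq (Wb p pP).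
  by rewrite /v ltnNge pP.
have ve p : v p < 2 ^ e.
  by apply: leq_ltn_trans (vpat p) _; rewrite /pat; case: ifP; rewrite ?expn_gt0.
exists (fun t f => v (n * t + f)); split.
- move=> t f lt lf; have := vpat (n * t + f); rewrite /pat ifT; last by nia.
  by rewrite mulnC modnMDl modn_small.
- by move=> k t lk lt; have := We k lk; rewrite ev => /eq_maskP; apply.
- by move: Wh; rewrite ev last_maskP.
Qed.

End Pack.

(** * Register programs and automata *)

Definition state := nat -> nat.
Definition upd (s : state) r v : state := fun q => if q == r then v else s q.

Lemma upd_eq s r v : upd s r v r = v.
Proof. by rewrite /upd eqxx. Qed.

Lemma upd_ne s r v q : q != r -> upd s r v q = s q.
Proof. by rewrite /upd => /negbTE ->. Qed.

Lemma updK s r v w : upd (upd s r v) r w = upd s r w.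
Proof. by apply: funext => q; rewrite /upd; case: eqP. Qed.

Lemma upd_id s r : upd s r (s r) = s.
Proof. by apply: funext => q; rewrite /upd; case: eqP => // ->. Qed.

Lemma updC s r q v w : r != q -> upd (upd s r v) q w = upd (upd s q w) r v.
Proof.
move=> ne; apply: funext => p; rewrite /upd; case: (p =P q) => // ->.
by rewrite eq_sym (negbTE ne).
Qed.

Inductive instr := Nop | Inc of nat | Dec of nat | Zer of nat.

Definition istep (i : instr) (s s' : state) : Prop :=
  match i with
  | Nop => s' = s
  | Inc r => s' = upd s r (s r).+1
  | Dec r => 0 < s r /\ s' = upd s r (s r).-1
  | Zer r => s r = 0 /\ s' = s
  end.

(** [Star] may stop after any number of rounds, which is the only source of nondeterminism; a [Dec]
    or [Zer] whose condition fails blocks the run. *)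
Inductive prog := Do of instr | Seq of prog & prog | Star of prog.

Inductive star (T : Type) (rel : T -> T -> Prop) : T -> T -> Prop :=
| star_refl s : star rel s s
| star_step s s1 s2 : star rel s s1 -> rel s1 s2 -> star rel s s2.

Lemma star_trans T (rel : T -> T -> Prop) s1 s2 s3 :
  star rel s1 s2 -> star rel s2 s3 -> star rel s1 s3.
Proof.
move=> r12 r23; elim: r23 r12 => [//|s s' s'' _ IH st r12].
exact: star_step (IH r12) st.
Qed.

Lemma star1 T (rel : T -> T -> Prop) s1 s2 : rel s1 s2 -> star rel s1 s2.
Proof. exact: star_step (star_refl _ _). Qed.

Lemma sub_star T (rel rel' : T -> T -> Prop) s s' :
  (forall x y, rel x y -> rel' x y) -> star rel s s' -> star rel' s s'.
Proof.
move=> sub; elim=> [x|x y z _ IH /sub]; [exact: star_refl | exact: star_step].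
Qed.

Fixpoint sem (p : prog) : state -> state -> Prop :=
  match p with
  | Do i => istep i
  | Seq p q => fun s s' => exists2 s1, sem p s s1 & sem q s1 s'
  | Star p => star (sem p)
  end.

Definition trans : Type := (nat * instr * nat)%type.

(** Here [s] and [e] are the entry and exit labels and [n] is the first fresh label; the second
    component returned is the next fresh label. *)
Fixpoint compile (p : prog) (s e n : nat) : seq trans * nat :=
  match p with
  | Do i => ([:: (s, i, e)], n)
  | Seq p q =>
      let c := compile p s n n.+1 in
      let c' := compile q n e c.2 in (c.1 ++ c'.1, c'.2)
  | Star p =>
      let c := compile p n n.+1 n.+2 in
      ([:: (s, Nop, n); (n.+1, Nop, n); (n, Nop, e)] ++ c.1, c.2)
  end.

Lemma compile_mono p s e n : n <= (compile p s e n).2.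
Proof.
elim: p s e n => [i|p IHp q IHq|p IHp] s e n //=.
  by apply: leq_trans (IHq _ _ _); apply: leq_trans (IHp _ _ _).
by apply: leq_trans (IHp _ _ _); lia.
Qed.

Fixpoint tmem (t : trans) (c : seq trans) : Prop :=
  if c is t' :: c' then t = t' \/ tmem t c' else False.

Lemma tmem_cat t c c' : tmem t (c ++ c') <-> tmem t c \/ tmem t c'.
Proof. by elim: c => [|t' c IH] /=; [tauto | rewrite IH; tauto]. Qed.

Definition cstep (c : seq trans) (x y : nat * state) : Prop :=
  exists2 i, tmem (x.1, i, y.1) c & istep i x.2 y.2.

Lemma compile_complete p s e n x y : sem p x y ->
  star (cstep (compile p s e n).1) (s, x) (e, y).
Proof.
have sub c c' a b : (forall t, tmem t c -> tmem t c') ->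
    star (cstep c) a b -> star (cstep c') a b.
  by move=> h; apply: sub_star => u v [i /h m st]; exists i.
elim: p s e n x y => [i|p IHp q IHq|p IHp] s e n x y /=.
- by move=> st; apply: star1; exists i => //; left.
- case=> z hp hq; apply: (@star_trans _ _ _ (n, z)).
    by apply: sub _ (IHp s n n.+1 _ _ hp) => t m; rewrite tmem_cat; left.
  by apply: sub _ (IHq n e (compile p s n n.+1).2 _ _ hq) => t m; rewrite tmem_cat; right.
- set c := _ :: _ :: _ :: _ => xy.
  apply: (@star_step _ _ _ (n, y)); last by exists Nop => //=; tauto.
  elim: xy => [z|z z1 z2 _ IH st]; first by apply: star1; exists Nop => //=; tauto.
  apply: star_step (_ : cstep c (n.+1, z2) _); last by exists Nop => //=; tauto.
  apply: star_trans IH _; apply: sub _ (IHp _ _ n.+2 _ _ st) => t m /=; tauto.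
Qed.

(* The predicates J are an inductive invariant, one assertion per label; they are
   fixed on the fresh labels [n, n') and determined by Pre at the entry and exit. *)
Lemma compile_sound p s e n (Pre : state -> Prop) : exists J : nat -> state -> Prop,
  forall K : nat -> state -> Prop,
    (forall q, n <= q < (compile p s e n).2 -> K q = J q) ->
    K s = Pre -> K e = (fun y => exists2 x, Pre x & sem p x y) ->
  forall a i b x y, tmem (a, i, b) (compile p s e n).1 -> istep i x y -> K a x -> K b y.
Proof.
elim: p s e n Pre => [i|p IHp q IHq|p IHp] s e n Pre /=.
- exists (fun _ _ => True) => K _ Ks Ke a j b x y [[-> -> ->]|[]] st.
  by rewrite Ks Ke => px; exists x.
- set post := fun y => exists2 x, Pre x & sem p x y.
  have [Jp hp] := IHp s n n.+1 Pre.
  have [Jq hq] := IHq n e (compile p s n n.+1).2 post.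
  have le1 := compile_mono p s n n.+1.
  have le2 := compile_mono q n e (compile p s n n.+1).2.
  exists (fun l => if l == n then post else
                   if l < (compile p s n n.+1).2 then Jp l else Jq l) => K KJ Ks Ke.
  have Kn : K n = post by rewrite KJ ?eqxx //; lia.
  move=> a i b x y /tmem_cat[]; [apply: hp => //|apply: hq => //].
  + by move=> l ll; rewrite KJ; [rewrite ifF ?ifT //; lia|lia].
  + by move=> l ll; rewrite KJ; [rewrite ifF ?ifF //; lia|lia].
  + rewrite Ke; apply: funext => z; apply: propext; split.
      by case=> u pu [v pv qv]; exists v => //; exists u.
    by case=> v [u pu pv] qv; exists u => //; exists v.
- set loop := fun y => exists2 x, Pre x & star (sem p) x y.
  set post := fun y => exists2 x, loop x & sem p x y.
  have [Jp hp] := IHp n n.+1 n.+2 loop.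
  have le1 := compile_mono p n n.+1 n.+2.
  exists (fun l => if l == n then loop else if l == n.+1 then post else Jp l) => K KJ Ks Ke.
  have Kn : K n = loop by rewrite KJ ?eqxx //; lia.
  have Kn1 : K n.+1 = post by rewrite KJ; [rewrite ifF ?eqxx //; lia | lia].
  move=> a i b x y [[-> -> ->]|[[-> -> ->]|[[-> -> ->]|]]] /=.
  + by move=> ->; rewrite Ks Kn => px; exists x => //; exact: star_refl.
  + move=> ->; rewrite Kn Kn1 => -[z [u pu zu] zx]; exists u => //; exact: star_step zu zx.
  + by move=> ->; rewrite Kn Ke.
  + by apply: hp => // l ll; rewrite KJ ?ifF ?ifF //; lia.
Qed.

Theorem compileP p x y : let c := (compile p 0 1 2).1 in
  sem p x y <-> star (cstep c) (0, x) (1, y).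
Proof.
split=> [|run]; first exact: compile_complete.
have [J hJ] := compile_sound p 0 1 2 (fun z => z = x).
pose K l := if l == 0 then (fun z => z = x) else
  if l == 1 then (fun z => exists2 u, u = x & sem p u z) else J l.
have /= inv := hJ K _ erefl erefl.
suff : K 1 y by case=> u ->.
have : forall a b, star (cstep (compile p 0 1 2).1) a b -> K a.1 a.2 -> K b.1 b.2.
  move=> a b; elim=> // u v w _ IH [i m st] /IH; apply: inv m st.
  by move=> q /andP[q2 _]; rewrite /K !ifF //; lia.
by move/(_ _ _ run); apply.
Qed.

(** * Verifying partial recursive functions *)

Definition agree m (s s' : state) := forall q, q < m -> s' q = s q.

Lemma agree_sym m s s' : agree m s s' -> agree m s' s.
Proof. by move=> h q lq; rewrite h. Qed.

Lemma agree_trans m s1 s2 s3 : agree m s1 s2 -> agree m s2 s3 -> agree m s1 s3.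
Proof. by move=> h h' q lq; rewrite h' // h. Qed.

Lemma agree_upd m s r v : m <= r -> agree m s (upd s r v).
Proof. by move=> le q lq; rewrite upd_ne // neq_ltn (leq_trans lq le). Qed.

Lemma agree_le m m' s s' : m' <= m -> agree m s s' -> agree m' s s'.
Proof. by move=> le h q lq; apply: h; apply: leq_trans le. Qed.

Lemma agree_map m s s' ins : all (fun q => q < m) ins -> agree m s s' -> map s' ins = map s ins.
Proof. by move=> /allP lt h; apply/eq_in_map => q /lt; apply: h. Qed.

Definition local m (Q : state -> Prop) := forall s s', agree m s s' -> Q s -> Q s'.

Definition tests p m (Q : state -> Prop) :=
  (forall s s', sem p s s' -> Q s /\ agree m s s') /\
  (forall s, Q s -> exists2 s', sem p s s' & agree m s s').

Lemma tests_ext p m Q Q' : (forall s, Q s <-> Q' s) -> tests p m Q -> tests p m Q'.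
Proof. by move=> e [h1 h2]; split=> [s s' /h1|s /e/h2] //; rewrite e. Qed.

Lemma tests_weaken p m m' Q : m' <= m -> tests p m Q -> tests p m' Q.
Proof.
move=> le [h1 h2]; split=> [s s' /h1[q a]|s /h2[s' ss' a]].
  by split=> //; apply: agree_le a.
by exists s' => //; apply: agree_le a.
Qed.

Lemma tests_and p q m Q Q' : local m Q' -> tests p m Q -> tests q m Q' ->
  tests (Seq p q) m (fun s => Q s /\ Q' s).
Proof.
move=> l [p1 p2] [q1 q2]; split=> [s s' [s1 /p1[qs a] /q1[qs' a']]|s [/p2[s1 ss1 a] qs]].
  by split; [split=> //; apply: l qs'; apply: agree_sym | apply: agree_trans a'].
have [s' s1s' a'] := q2 _ (l _ _ a qs).
by exists s'; [exists s1 | apply: agree_trans a'].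
Qed.

Lemma star_Inc r s s' : star (istep (Inc r)) s s' <-> exists v, s' = upd s r (s r + v).
Proof.
split=> [|[v ->]].
  elim=> [x|x y z _ [v ->] /= ->]; first by exists 0; rewrite addn0 upd_id.
  by exists v.+1; rewrite upd_eq updK addnS.
elim: v => [|v IH]; first by rewrite addn0 upd_id; exact: star_refl.
by apply: star_step IH _; rewrite /= upd_eq updK addnS.
Qed.

Lemma star_Dec r s s' : star (istep (Dec r)) s s' <-> exists2 v, v <= s r & s' = upd s r (s r - v).
Proof.
split=> [|[v le ->]].
  elim=> [x|x y z _ [v le ->] /= []]; first by exists 0; rewrite ?subn0 ?upd_id.
  by rewrite upd_eq updK => lt ->; exists v.+1; [lia | congr upd; lia].
elim: v le => [|v IH] le; first by rewrite subn0 upd_id; exact: star_refl.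
apply: star_step (IH (ltnW le)) _; rewrite /= upd_eq updK; split; first lia.
by congr upd; lia.
Qed.

(** A nondeterministic assignment: any value is reached by counting down to 0 and then up. *)
Definition havoc r := Seq (Star (Do (Dec r))) (Star (Do (Inc r))).

Lemma havocP r s s' : sem (havoc r) s s' <-> exists v, s' = upd s r v.
Proof.
split=> [[s1 /star_Dec[v _ ->] /star_Inc[w ->]]|[v ->]].
  by rewrite updK; eexists.
exists (upd s r 0).
  by apply/star_Dec; exists (s r); rewrite ?subnn.
by apply/star_Inc; exists v; rewrite upd_eq updK.
Qed.

(** Guessing a scratch register is an existential quantifier. *)
Lemma tests_ex r p m Q : m <= r -> tests p m Q ->
  tests (Seq (havoc r) p) m (fun s => exists v, Q (upd s r v)).
Proof.
move=> le [p1 p2]; split=> [s s' [s1 /havocP[v ->] /p1[q a]]|s [v /p2[s' ss' a]]].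
  by split; [exists v | apply: agree_trans a; apply: agree_upd].
exists s'; first by exists (upd s r v) => //; apply/havocP; exists v.
by apply: agree_trans a; apply: agree_upd.
Qed.

(** Lower [x] and [y] together while counting in [k], require both to be 0, then rebuild them from
    [k]. The initial guess followed by a zero test is a reset of [k]. *)
Definition eqtest x y k :=
  Seq (havoc k) (Seq (Do (Zer k))
  (Seq (Star (Seq (Do (Dec x)) (Seq (Do (Dec y)) (Do (Inc k)))))
  (Seq (Do (Zer x)) (Seq (Do (Zer y))
  (Seq (Star (Seq (Do (Dec k)) (Seq (Do (Inc x)) (Do (Inc y)))))
  (Do (Zer k))))))).

Lemma eqtestP x y k s s' : x != y -> x != k -> y != k ->
  sem (eqtest x y k) s s' <-> s x = s y /\ s' = upd s k 0.
Proof.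
move=> nxy nxk nyk.
pose st a b c := upd (upd (upd s x a) y b) k c.
have stx a b c : st a b c x = a by rewrite /st upd_ne // upd_ne // upd_eq.
have sty a b c : st a b c y = b by rewrite /st upd_ne // upd_eq.
have stk a b c : st a b c k = c by rewrite /st upd_eq.
have updx a b c v : upd (st a b c) x v = st v b c.
  apply: funext => q; rewrite /st /upd; case: (q =P x) => // ->.
  by rewrite (negbTE nxk) (negbTE nxy).
have updy a b c v : upd (st a b c) y v = st a v c.
  apply: funext => q; rewrite /st /upd; case: (q =P y) => // ->.
  by rewrite (negbTE nyk).
have updk a b c v : upd (st a b c) k v = st a b v by rewrite /st updK.
have st0 v : upd s k v = st (s x) (s y) v by rewrite /st !upd_id.
have down a b c t : star (sem (Seq (Do (Dec x)) (Seq (Do (Dec y)) (Do (Inc k))))) (st a b c) t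
    <-> exists2 v, v <= minn a b & t = st (a - v) (b - v) (c + v).
  split=> [|[v le ->]].
    move e: (st a b c) => u h; elim: h e => [u' <-|u' u1 u2 _ IH /= st1 e].
      by exists 0; rewrite ?subn0 ?addn0.
    have [v le e1] := IH e; move: st1; rewrite e1.
    case=> _ [+ ->] [_ [+ ->] ->]; rewrite stx updx sty updy stk updk => lx ly.
    by exists v.+1; [lia | congr st; lia].
  elim: v le => [|v IH] le; first by rewrite !subn0 addn0; exact: star_refl.
  apply: star_step (IH (ltnW le)) _.
  exists (st (a - v.+1) (b - v) (c + v)); first by rewrite /= stx updx; split; [lia | congr st; lia].
  exists (st (a - v.+1) (b - v.+1) (c + v)); first by rewrite /= sty updy; split; [lia | congr st; lia].
  by rewrite /= stk updk addnS.
have up a b c t : star (sem (Seq (Do (Dec k)) (Seq (Do (Inc x)) (Do (Inc y))))) (st a b c) t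
    <-> exists2 v, v <= c & t = st (a + v) (b + v) (c - v).
  split=> [|[v le ->]].
    move e: (st a b c) => u h; elim: h e => [u' <-|u' u1 u2 _ IH /= st1 e].
      by exists 0; rewrite ?subn0 ?addn0.
    have [v le e1] := IH e; move: st1; rewrite e1.
    case=> _ [+ ->] [_ -> ->]; rewrite !stk !updk !stx !updx !sty !updy => lk.
    by exists v.+1; [lia | congr st; lia].
  elim: v le => [|v IH] le; first by rewrite subn0 !addn0; exact: star_refl.
  apply: star_step (IH (ltnW le)) _.
  exists (st (a + v) (b + v) (c - v.+1)); first by rewrite /= stk updk; split; [lia | congr st; lia].
  exists (st (a + v.+1) (b + v) (c - v.+1)); first by rewrite /= stx updx addnS.
  by rewrite /= sty updy !addnS.
split.
- case=> _ /havocP[v ->] [_ [+ ->]]; rewrite st0 stk => ->.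
  case=> _ /down[w le ->] [_ [+ ->]] [_ [+ ->]]; rewrite stx sty => ex ey.
  case=> _ /up[i lei ->] [+ ->]; rewrite stk st0 => ei.
  by split; [lia | congr st; lia].
- case=> exy ->; exists (upd s k 0); first by apply/havocP; exists 0.
  rewrite st0; exists (st (s x) (s y) 0); first by rewrite /= stk.
  exists (st 0 0 (s x)).
    by apply/down; exists (s x); [lia | congr st; lia].
  exists (st 0 0 (s x)); first by rewrite /= stx.
  exists (st 0 0 (s x)); first by rewrite /= sty.
  exists (st (s x) (s y) 0); last by rewrite /= stk.
  by apply/up; exists (s x); [lia | congr st; lia].
Qed.

Lemma tests_eq x y k m : x != y -> x < m -> y < m -> m <= k ->
  tests (eqtest x y k) m (fun s => s x = s y).
Proof.
move=> ne lx ly lk.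
have P s s' := @eqtestP x y k s s' ne.
have nx : x != k by rewrite neq_ltn (leq_trans lx lk).
have ny : y != k by rewrite neq_ltn (leq_trans ly lk).
split=> [s s' /P[] // e ->|s e]; first by split=> //; apply: agree_upd.
by exists (upd s k 0); [apply/P | apply: agree_upd].
Qed.

Lemma tests_Zer x m : tests (Do (Zer x)) m (fun s => s x = 0).
Proof. by split=> [s s' [e ->]|s e] //; exists s. Qed.

Definition loop_step (Rel : state -> nat -> nat -> nat -> Prop) s (p q : nat * nat) :=
  q.1 = p.1.+1 /\ Rel s p.1 p.2 q.2.

(** A common pattern for recursion and minimisation: register [m] counts the rounds, register [m.+1]
    is an accumulator updated according to [Rel], and [p0] and [p1] check the situation before and
    after the loop. *)
Lemma tests_loop m B Rel p0 p1 Q0 Q1 :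
  (forall s s' i a z, agree m s s' -> Rel s i a z -> Rel s' i a z) ->
  (forall s s', sem B s s' ->
     [/\ Rel s (s m) (s m.+1) (s' m.+1), s' m = (s m).+1 & agree m s s']) ->
  (forall s z, Rel s (s m) (s m.+1) z ->
     exists s', [/\ sem B s s', s' m.+1 = z, s' m = (s m).+1 & agree m s s']) ->
  local m.+2 Q1 -> tests p0 m.+2 Q0 -> tests p1 m.+2 Q1 ->
  tests (Seq p0 (Seq (Star B) p1)) m (fun s => Q0 s /\
    exists i a, star (loop_step Rel s) (s m, s m.+1) (i, a) /\ Q1 (upd (upd s m i) m.+1 a)).
Proof.
move=> Rloc B1 B2 Qloc [p01 p02] [p11 p12].
have updm s i a : upd (upd s m i) m.+1 a m = i by rewrite upd_ne ?upd_eq //; lia.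
have updS s i a : upd (upd s m i) m.+1 a m.+1 = a by rewrite upd_eq.
have agm s s' : agree m s s' -> agree m.+2 s' (upd (upd s m (s' m)) m.+1 (s' m.+1)).
  move=> h q lq; rewrite /upd; case: eqP => [-> //|n1]; case: eqP => [-> //|n2].
  by rewrite h //; lia.
have sound s s' : star (sem B) s s' ->
    agree m s s' /\ star (loop_step Rel s) (s m, s m.+1) (s' m, s' m.+1).
  elim=> [u|u v w _ [a1 st] /B1[r e a2]]; first by split; [|exact: star_refl].
  split; first exact: agree_trans a1 a2.
  apply: star_step st _; split=> //=.
  by apply: Rloc r; apply: agree_sym.
have compl s x y : star (loop_step Rel s) x y -> forall s1, agree m s s1 -> x = (s1 m, s1 m.+1) ->
    exists s2, [/\ star (sem B) s1 s2, agree m s s2 & y = (s2 m, s2 m.+1)].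
  elim=> [u s1 a ->|u v w _ IH [e r] s1 a eu]; first by exists s1; split=> //; exact: star_refl.
  have [s2 [st a2 ev]] := IH s1 a eu; move: e r; rewrite ev /= => e r.
  have [s3 [b3 e3 e3' a3]] := B2 s2 _ (Rloc _ _ _ _ _ a2 r).
  exists s3; split; [exact: star_step st b3 | exact: agree_trans a2 a3 |].
  by rewrite e3 e3' -e -surjective_pairing.
split=> [s s' [s0 /p01[q0 a0] [s1 /sound[a1 st] /p11[q1 a2]]]|s [q0 [i [a [st q1]]]]].
  have a0' : agree m s s0 by apply: agree_le a0; lia.
  have a01 := agree_trans a0' a1.
  split; last by apply: agree_trans a01 (agree_le _ a2); lia.
  split=> //; exists (s1 m), (s1 m.+1); split; last by apply: Qloc (agm _ _ a01) q1.
  rewrite -(a0 m) // -(a0 m.+1) //; apply: sub_star st => p q [e r]; split=> //.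
  by apply: Rloc r; apply: agree_sym.
have [s0 h0 a0] := p02 _ q0.
have a0' : agree m s s0 by apply: agree_le a0; lia.
have [|s1 [h1 a1 [ei ea]]] := compl s _ _ st s0 a0'; first by rewrite !a0.
move: q1; rewrite ei ea => q1.
have [s' h2 a2] := p12 s1 (Qloc _ _ (agree_sym (agm _ _ a1)) q1).
exists s'; first by exists s0 => //; exists s1.
by apply: agree_trans a1 (agree_le _ a2); lia.
Qed.

(* A program that halts iff f maps the registers [ins] to the register [out];
   the registers from m on are scratch. *)
Fixpoint verif n (f : prf n) (ins : seq nat) (out m : nat) : prog :=
  match f with
  | Zero _ => Do (Zer out)
  | Succ => Seq (Do (Dec out)) (Seq (eqtest out (head 0 ins) m) (Do (Inc out)))
  | Proj _ i => eqtest out (nth 0 ins i) m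
  | Comp k _ f g =>
      foldr (fun i p => Seq (havoc (m + i)) p)
        (foldr (fun i p => Seq (verif (g i) ins (m + i) (m + k)) p)
           (verif f (iota m k) out (m + k)) (enum 'I_k))
        (iota 0 k)
  | Prec _ f g =>
      Seq (havoc m) (Seq (havoc m.+1)
      (Seq (Seq (Do (Zer m)) (verif f (behead ins) m.+1 m.+2))
      (Seq (Star (Seq (havoc m.+2) (Seq (eqtest m.+1 m.+2 m.+3) (Seq (havoc m.+1)
             (Seq (verif g [:: m, m.+2 & behead ins] m.+1 m.+3) (Do (Inc m)))))))
           (Seq (eqtest m (head 0 ins) m.+2) (eqtest m.+1 out m.+2)))))
  | Mu _ f =>
      Seq (havoc m)
      (Seq (Do (Zer m))
      (Seq (Star (Seq (havoc m.+2) (Seq (Do (Inc m.+2))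
             (Seq (verif f (m :: ins) m.+2 m.+3) (Do (Inc m))))))
           (Seq (eqtest m out m.+2)
           (Seq (havoc m.+2) (Seq (Do (Zer m.+2)) (verif f (m :: ins) m.+2 m.+3))))))
  end.

Definition verif_spec n (f : prf n) (ins : seq nat) (out : nat) (s : state) :=
  exists2 v : n.-tuple nat, tval v = map s ins & computes f v (s out).

Lemma verif_spec_local n (f : prf n) ins out m :
  all (fun q => q < m) ins -> out < m -> local m (verif_spec f ins out).
Proof.
move=> li lo s s' a [v e c]; exists v; first by rewrite e (agree_map li a).
by rewrite a.
Qed.

Lemma tests_foldr (T : eqType) m (p : T -> prog) (Q : T -> state -> Prop) q Qq (l : seq T) :
  (forall i, local m (Q i)) -> local m Qq -> (forall i, tests (p i) m (Q i)) -> tests q m Qq ->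
  local m (fun s => (forall i, i \in l -> Q i s) /\ Qq s) /\
  tests (foldr (fun i p' => Seq (p i) p') q l) m (fun s => (forall i, i \in l -> Q i s) /\ Qq s).
Proof.
move=> lQ lq tp tq; elim: l => [|i l [IHl IHt]] /=.
  split=> [s s' a [_ h]|]; first by split=> //; apply: lq h.
  by apply: tests_ext tq => s; split=> [h|[]].
split=> [s s' a [h h']|].
  by split=> [j jl|]; [apply: lQ (h j jl) | apply: lq h'].
apply: tests_ext (tests_and IHl (tp i) IHt) => s; split=> [[h [h1 h2]]|[h h']].
  by split=> // j; rewrite inE => /orP[/eqP ->|/h1].
split; first by apply: h; rewrite mem_head.
by split=> // j jl; apply: h; rewrite inE jl orbT.
Qed.

Lemma tests_havocs m p Q k : tests p m Q ->
  tests (foldr (fun i p' => Seq (havoc (m + i)) p') p (iota 0 k)) m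
    (fun s => exists s', [/\ agree m s s', forall q, m + k <= q -> s' q = s q & Q s']).
Proof.
(* The induction needs arbitrary lists of offsets, because the tail of [iota 0 k] no longer starts
   at 0. *)
have gen l : tests p m Q ->
   tests (foldr (fun i p' => Seq (havoc (m + i)) p') p l) m
    (fun s => exists s', (forall q, (q \notin map (addn m) l) -> s' q = s q) /\ Q s').
  move=> tp; elim: l => [|i l IH] /=.
    apply: tests_ext tp => s; split=> [q|[s' [e]]]; first by exists s.
    by rewrite (_ : s' = s) //; apply: funext => q; apply: e.
  apply: tests_ext (tests_ex (leq_addr i m) IH) => s; split.
    case=> v [s' [e q]]; exists s'; split=> // r; rewrite inE negb_or => /andP[n1 n2].
    by rewrite e // upd_ne.
  case=> s' [e q]; exists (s' (m + i)), s'; split=> // r nr.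
  rewrite /upd; case: eqP => [-> //|/eqP n]; apply: e.
  by rewrite inE negb_or n.
move=> tp; apply: tests_ext (gen (iota 0 k) tp) => s.
have inr q : (q \in map (addn m) (iota 0 k)) = (m <= q < m + k).
  by rewrite -iotaDl addn0 mem_iota.
split=> [[s' [e q]]|[s' [a e q]]]; exists s'; split=> //.
- by move=> r lr; apply: e; rewrite inr; lia.
- by move=> r lr; apply: e; rewrite inr; lia.
- move=> r; rewrite inr => nr; case: (ltnP r m) => lr; first exact: a.
  by apply: e; lia.
Qed.

Lemma map_iota_tuple k (w : k.-tuple nat) (s : state) m :
  tval w = map s (iota m k) <-> forall i, tnth w i = s (m + i).
Proof.
split=> [e i|h].
  by rewrite (tnth_nth 0) e (nth_map 0) ?size_iota // nth_iota.
apply: (@eq_from_nth _ 0); rewrite size_tuple ?size_map ?size_iota // => i li.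
by rewrite (nth_map 0) ?size_iota // nth_iota // -(h (Ordinal li)) (tnth_nth 0).
Qed.

Lemma tuple_map_size n (ins : seq nat) (s : state) : size ins = n ->
  exists v : n.-tuple nat, tval v = map s ins.
Proof. by move=> <-; exists (map_tuple s (in_tuple ins)). Qed.

Lemma verif_specE n (f : prf n) ins out s (v : n.-tuple nat) : tval v = map s ins ->
  verif_spec f ins out s <-> computes f v (s out).
Proof.
move=> e; split=> [[w ew]|c]; last by exists v.
by rewrite (_ : w = v) //; apply: val_inj; rewrite /= ew e.
Qed.

Lemma map_upd_ge s m q v ins : all (fun q => q < m) ins -> m <= q ->
  map (upd s q v) ins = map s ins.
Proof. by move=> lt le; apply: agree_map lt _; apply: agree_upd. Qed.

Lemma all_ltW m m' ins : m <= m' -> all (fun q => q < m) ins -> all (fun q => q < m') ins.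
Proof. by move=> le; apply: sub_all => q lq; apply: leq_trans le. Qed.

Lemma ge_notin m q ins : all (fun q => q < m) ins -> m <= q -> q \notin ins.
Proof. by move=> /allP lt le; apply/negP => /lt; lia. Qed.

(** The output must differ from the inputs because [eqtest] compares distinct registers. *)
Definition verif_ok n (f : prf n) := forall ins out m, size ins = n ->
  all (fun q => q < m) ins -> out < m -> out \notin ins ->
  tests (verif f ins out m) m (verif_spec f ins out).

Lemma verif_ok_Succ : verif_ok Succ.
Proof.
move=> [|x []] //= out m _; rewrite andbT mem_seq1 => lx lo ne.
have E s : verif_spec Succ [:: x] out s <-> s out = (s x).+1.
  by rewrite (@verif_specE _ Succ [:: x] out s [tuple s x]).
have nx : x != m by rewrite neq_ltn lx.
have nom : out != m by rewrite neq_ltn lo.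
split=> [s s' [s1 [l ->] [s2 /eqtestP[] // + -> ->]]|s].
  rewrite upd_eq upd_ne 1?eq_sym // => e; split; first by apply/E; lia.
  rewrite [X in upd _ _ X.+1]upd_ne // upd_eq prednK // updC 1?eq_sym // updK upd_id.
  exact: agree_upd.
move=> /E e; exists (upd s m 0); last exact: agree_upd.
exists (upd s out (s out).-1); first by split; [lia|].
exists (upd (upd s out (s out).-1) m 0).
  by apply/eqtestP => //; rewrite upd_eq upd_ne 1?eq_sym // e.
rewrite /= upd_ne // upd_eq prednK; last lia.
by rewrite updC 1?eq_sym // updK upd_id.
Qed.

(** The intermediate values are guessed in the registers from [m] to [m + k - 1], each is checked
    against its [g i], and [f] is then checked on them; the parts use scratch space from [m + k]
    on. *)
Lemma verif_ok_Comp k n (f : prf k) (g : 'I_k -> prf n) :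
  verif_ok f -> (forall i, verif_ok (g i)) -> verif_ok (Comp f g).
Proof.
move=> okf okg ins out m sz li lo no /=.
have li' := all_ltW (leq_addr k m) li.
have lo' : out < m + k by apply: leq_trans lo (leq_addr _ _).
have liota : all (fun q => q < m + k) (iota m k) by apply/allP => q; rewrite mem_iota; lia.
have noiota : out \notin iota m k by rewrite mem_iota; lia.
have [_ T] : local (m + k) (fun s => (forall i, i \in enum 'I_k -> verif_spec (g i) ins (m + i) s)
      /\ verif_spec f (iota m k) out s) /\
    tests (foldr (fun i p => Seq (verif (g i) ins (m + i) (m + k)) p)
           (verif f (iota m k) out (m + k)) (enum 'I_k)) (m + k)
    (fun s => (forall i, i \in enum 'I_k -> verif_spec (g i) ins (m + i) s)
      /\ verif_spec f (iota m k) out s).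
  apply: tests_foldr => [i||i|].
  - by apply: verif_spec_local => //; rewrite ltn_add2l.
  - exact: verif_spec_local.
  - by apply: okg => //; [rewrite ltn_add2l | apply: ge_notin li _; apply: leq_addr].
  - by apply: okf; rewrite ?size_iota.
apply: tests_ext (tests_havocs k (tests_weaken (leq_addr k m) T)) => s.
have [v ev] := tuple_map_size s sz.
rewrite (verif_specE _ _ ev) /=; split.
  case=> s' [a _ [hg [w ew hf]]]; exists w; split; last by rewrite -(a out lo).
  move=> i; rewrite (proj1 (map_iota_tuple w s' m) ew).
  by apply/(@verif_specE _ (g i) ins); [rewrite (agree_map li a) | apply: hg; rewrite mem_enum].
case=> w [hg hf].
pose s' q := if m <= q < m + k then nth 0 w (q - m) else s q.
have a : agree m s s' by move=> q lq; rewrite /s' ifF //; lia.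
have s'w (i : 'I_k) : s' (m + i) = tnth w i.
  by rewrite /s' leq_addr ltn_add2l ltn_ord addKn (tnth_nth 0).
exists s'; split=> // [q lq|]; first by rewrite /s' ifF //; lia.
split=> [i _|].
  by apply/(@verif_specE _ (g i) ins _ s' v); rewrite ?s'w // (agree_map li a).
exists w; first by apply/map_iota_tuple.
by rewrite a.
Qed.

Lemma tuple_cons2 n (ins : seq nat) (s : state) a b (v : n.-tuple nat) x y :
  tval v = map s ins -> s a = x -> s b = y ->
  tval [tuple of x :: y :: v] = map s [:: a, b & ins].
Proof. by move=> /= -> -> ->. Qed.

Definition prec_graph n (f : prf n) (g : prf n.+2) (u : n.-tuple nat) :=
  fix rec k y : Prop :=
    if k is k'.+1 then exists z, rec k' z /\ computes g [tuple of k' :: z :: u] y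
    else computes f u y.

Lemma computes_Prec n (f : prf n) (g : prf n.+2) (x : nat) (v : n.-tuple nat) y :
  computes (Prec f g) [tuple of x :: v] y <-> prec_graph f g v x y.
Proof.
have e : behead_tuple [tuple of x :: v] = v by apply: val_inj.
have : computes (Prec f g) [tuple of x :: v] y
  <-> prec_graph f g (behead_tuple [tuple of x :: v]) x y by [].
by rewrite e.
Qed.

(** Register [m] holds the recursion index and [m.+1] the value there. A round copies the old value
    to [m.+2] by guessing it and testing equality, guesses the new value in [m.+1], and verifies it
    with [g]. *)
Lemma verif_ok_Prec n (f : prf n) (g : prf n.+2) : verif_ok f -> verif_ok g -> verif_ok (Prec f g).
Proof.
move=> okf okg [//|x0 ins] out m [sz] /andP[lx li] lo; rewrite inE negb_or => /andP[nx no] /=.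
set B := Seq (havoc m.+2) _.
have li1 := all_ltW (leqnSn m) li; have li2 := all_ltW (leqnSn m.+1) li1.
have li3 := all_ltW (leqnSn m.+2) li2.
have l3 : m <= m.+3 by lia.
have nm : m \notin ins by apply: ge_notin li _.
have nm1 : m.+1 \notin ins by apply: ge_notin li _; lia.
pose Rel (s : state) i a z := exists2 v : n.-tuple nat, tval v = map s ins
   & computes g [tuple of i :: a :: v] z.
have [tg1 tg2] : tests (verif g [:: m, m.+2 & ins] m.+1 m.+3) m.+3
    (verif_spec g [:: m, m.+2 & ins] m.+1).
  by apply: okg; rewrite /= ?sz ?li3 ?inE ?negb_or ?nm1 //; lia.
have E s v : tval v = map s ins ->
    verif_spec g [:: m, m.+2 & ins] m.+1 s <-> computes g [tuple of s m :: s m.+2 :: v] (s m.+1).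
  by move=> ev; apply: verif_specE; apply: tuple_cons2.
have Rloc s s' i a z : agree m s s' -> Rel s i a z -> Rel s' i a z.
  by move=> ag [v ev c]; exists v => //; rewrite (agree_map li ag).
have T : tests (Seq (Seq (Do (Zer m)) (verif f ins m.+1 m.+2))
      (Seq (Star B) (Seq (eqtest m x0 m.+2) (eqtest m.+1 out m.+2)))) m
   (fun s => (s m = 0 /\ verif_spec f ins m.+1 s) /\
     exists i a, star (loop_step Rel s) (s m, s m.+1) (i, a) /\
      let s' := upd (upd s m i) m.+1 a in s' m = s' x0 /\ s' m.+1 = s' out).
  apply: (tests_loop (Q1 := fun s => s m = s x0 /\ s m.+1 = s out)) Rloc _ _ _ _ _.
  - move=> s s' [_ /havocP[old ->] [t /eqtestP[|||]]]; rewrite ?upd_eq ?upd_ne //; try by clear; lia.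
    move=> eo -> [_ /havocP[z ->] [s1 h1 ->]].
    have [cs a] := tg1 _ _ h1; set s2 := upd (upd (upd _ _ _) _ _) _ _ in cs a.
    have a' : agree m s s2.
      by move=> q lq; rewrite /s2 !upd_ne //; clear -lq; lia.
    have [v ev] := tuple_map_size s sz.
    have e2m : s2 m = s m by rewrite /s2 !upd_ne //; clear; lia.
    have e2o : s2 m.+2 = s m.+1 by rewrite /s2 /upd; do !case: eqP => //; clear; lia.
    split.
    + rewrite upd_ne ?a //; last by clear; lia.
      exists v => //; rewrite -e2m -e2o; apply/E => //.
      by rewrite (agree_map li a').
    + by rewrite upd_eq a ?e2m //; clear; lia.
    + exact: agree_trans a' (agree_trans (agree_le l3 a) (agree_upd _ _ (leqnn m))).
  - move=> s z [v ev c].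
    set s1 := upd s m.+2 (s m.+1).
    set s2 := upd (upd s1 m.+3 0) m.+1 z.
    have a' : agree m s s2.
      by move=> q lq; rewrite /s2 /s1 !upd_ne //; clear -lq; lia.
    have e2m : s2 m = s m by rewrite /s2 /s1 !upd_ne //; clear; lia.
    have e2z : s2 m.+1 = z by rewrite /s2 upd_eq.
    have e2o : s2 m.+2 = s m.+1 by rewrite /s2 /s1 /upd; do !case: eqP => //; clear; lia.
    have [|s3 h3 a3] := tg2 s2.
      by apply/(E _ v); rewrite ?(agree_map li a') // e2m e2o e2z.
    exists (upd s3 m (s3 m).+1); split.
    + exists s1; first by apply/havocP; eexists.
      exists (upd s1 m.+3 0).
        apply/eqtestP; try by clear; lia; split=> //.
        by rewrite /s1 upd_eq upd_ne //; clear; lia.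
      exists s2; first by apply/havocP; eexists.
      by exists s3.
    + by rewrite upd_ne ?a3 //; clear; lia.
    + by rewrite upd_eq a3 ?e2m //; clear; lia.
    + exact: agree_trans a' (agree_trans (agree_le l3 a3) (agree_upd _ _ (leqnn m))).
  - move=> s s' a [e1 e2]; rewrite !a //; clear -lx lo; lia.
  - apply: tests_and; [|exact: tests_Zer|].
      by apply: verif_spec_local => //; clear; lia.
    by apply: okf.
  - apply: tests_and.
    + by move=> s s' a e; rewrite !a //; clear -lx lo; lia.
    + by apply: tests_eq => //; clear -lx lo; lia.
    + by apply: tests_eq => //; clear -lx lo; lia.
apply: tests_ext (tests_ex (leqnn m) (tests_ex (leqnSn m) T)) => s.
have [v ev] := tuple_map_size s sz.
pose w : n.+1.-tuple nat := [tuple of s x0 :: v].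
have ew : tval w = map s (x0 :: ins) by rewrite /= ev.
rewrite (verif_specE _ _ ew) /w computes_Prec.
have Relv s' i a z : agree m s s' -> Rel s' i a z <-> computes g [tuple of i :: a :: v] z.
  move=> ag; split=> [[u eu]|c]; last by exists v => //; rewrite (agree_map li ag).
  by rewrite (_ : u = v) //; apply: val_inj; rewrite /= eu ev (agree_map li ag).
pose R p q := q.1 = p.1.+1 /\ computes g [tuple of p.1 :: p.2 :: v] q.2.
have RelR s' p q : agree m s s' -> star (loop_step Rel s') p q <-> star R p q.
  move=> ag; split; apply: sub_star => x y [e r]; split=> //; exact/(Relv _ _ _ _ ag).
have ag i a : agree m s (upd (upd s m i) m.+1 a).
  by move=> q lq; rewrite !upd_ne // neq_ltn ?(leqW lq) ?lq.
have um i a : upd (upd s m i) m.+1 a m = i by rewrite upd_ne ?upd_eq // neq_ltn leqnn.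
have fE i a : verif_spec f ins m.+1 (upd (upd s m i) m.+1 a) <-> computes f v a.
  rewrite (@verif_specE _ f ins m.+1 _ v) ?upd_eq //.
  by rewrite (agree_map li (ag _ _)).
have finE i a k y : (let s' := upd (upd (upd (upd s m i) m.+1 a) m k) m.+1 y in
    s' m = s' x0 /\ s' m.+1 = s' out) <-> k = s x0 /\ y = s out.
  have a' : agree m s (upd (upd (upd (upd s m i) m.+1 a) m k) m.+1 y).
    by move=> q lq; rewrite !upd_ne // neq_ltn ?(leqW lq) ?lq.
  by rewrite /= (a' x0 lx) (a' out lo) upd_eq upd_ne ?upd_eq // neq_ltn leqnn.
split.
  case=> k0 [a0 [[]]]; rewrite um => -> /fE ca [k [y [+ /finE[<- <-]]]].
  rewrite upd_eq RelR //.
  (* Loop invariant: the accumulator is the value of the recursion at the counter. *)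
  have : forall p q, star R p q -> prec_graph f g v p.1 p.2 -> prec_graph f g v q.1 q.2.
    move=> p q; elim=> // x y' z _ IH [e r] /IH h; rewrite e /=; by exists y'.2.
  by move=> h /h; apply.
have H k y : prec_graph f g v k y -> exists2 a0, computes f v a0 & star R (0, a0) (k, y).
  elim: k y => [|k IH] y /=; first by move=> c; exists y => //; exact: star_refl.
  case=> z [/IH[a0 c st] cz]; exists a0 => //; exact: star_step st _.
move=> /H[a0 ca st]; exists 0, a0; split; first by rewrite um fE.
by exists (s x0), (s out); rewrite um upd_eq RelR //; split=> //; apply/finE.
Qed.

(** Each round certifies a positive value of [f] at the counter [m], by guessing a number and
    incrementing it before verification; after the loop the value 0 is verified. The accumulator
    [m.+1] stays constant. *)
Lemma verif_ok_Mu n (f : prf n.+1) : verif_ok f -> verif_ok (Mu f).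
Proof.
move=> okf ins out m sz li lo no /=.
set B := Seq (havoc m.+2) (Seq (Do (Inc m.+2)) _).
have [l1 l2] : m <= m.+2 /\ m <= m.+3 by lia.
have n1 : m != m.+1 by rewrite neq_ltn leqnn.
have n2 : m != m.+2 by rewrite neq_ltn leqnSn.
have n12 : m.+1 != m.+2 by rewrite neq_ltn leqnn.
have li3 := all_ltW l2 li.
have [tf1 tf2] : tests (verif f (m :: ins) m.+2 m.+3) m.+3 (verif_spec f (m :: ins) m.+2).
  apply: okf => //=; rewrite ?sz ?li3 ?andbT //.
  by rewrite inE negb_or eq_sym n2 (ge_notin li).
have E s v : tval v = map s ins ->
    verif_spec f (m :: ins) m.+2 s <-> computes f [tuple of s m :: v] (s m.+2).
  by move=> ev; apply: verif_specE; rewrite /= ev.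
pose Rel (s : state) i (a z : nat) := z = a /\ exists2 v : n.-tuple nat,
   tval v = map s ins & exists t, computes f [tuple of i :: v] t.+1.
have Rloc s s' i a z : agree m s s' -> Rel s i a z -> Rel s' i a z.
  by move=> ag [e [v ev c]]; split=> //; exists v => //; rewrite (agree_map li ag).
have T0 : tests (Seq (havoc m.+2) (Seq (Do (Zer m.+2)) (verif f (m :: ins) m.+2 m.+3))) m.+2
    (fun s => exists t, let s' := upd s m.+2 t in s' m.+2 = 0 /\ verif_spec f (m :: ins) m.+2 s').
  apply: (@tests_ex m.+2 _ m.+2 (fun s' => s' m.+2 = 0 /\ verif_spec f (m :: ins) m.+2 s')) => //.
  apply: (tests_weaken (leqnSn m.+2)); apply: tests_and; [|exact: tests_Zer|by split].
  apply: verif_spec_local => //=; rewrite li3 andbT ltnS //.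
have T1 : tests (Seq (eqtest m out m.+2)
      (Seq (havoc m.+2) (Seq (Do (Zer m.+2)) (verif f (m :: ins) m.+2 m.+3)))) m.+2
    (fun s => s m = s out /\ verif_spec f (m :: ins) m.+2 (upd s m.+2 0)).
  apply: tests_ext (tests_and _ (tests_eq _ _ _ (leqnn m.+2)) T0); first 1 last.
  - move=> s s' a [t [/= e [v ev c]]]; exists t; rewrite /= !upd_eq in e c *; split=> //.
    exists v; rewrite ?upd_eq //.
    rewrite ev /= !upd_ne // a ?ltnS ?leqnSn //; congr (_ :: _).
    rewrite !(map_upd_ge _ _ li) //; apply/esym/(agree_map li)/(agree_le l1 a).
  - by rewrite eq_sym neq_ltn lo.
  - by rewrite ltnS leqnSn.
  - by rewrite ltnS ltnW // ltnW.
  move=> s; split=> [[e [t]]|[e c]]; last by split=> //; exists 0; rewrite /= upd_eq.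
  by rewrite /= upd_eq => -[-> ?].
have loc1 : local m.+2 (fun s => s m = s out /\ verif_spec f (m :: ins) m.+2 (upd s m.+2 0)).
  move=> s s' a [e [v ev c]].
  have lom : out < m.+2 by apply: ltn_trans lo _; rewrite ltnS leqnSn.
  have lmm : m < m.+2 by rewrite ltnS leqnSn.
  split; first by rewrite !a.
  exists v; last by rewrite !upd_eq in c *.
  rewrite ev /= !upd_ne // a //; congr (_ :: _).
  by rewrite !(map_upd_ge _ _ li) //; apply/esym/(agree_map li)/(agree_le l1 a).
have T : tests (Seq (Do (Zer m)) (Seq (Star B) (Seq (eqtest m out m.+2)
      (Seq (havoc m.+2) (Seq (Do (Zer m.+2)) (verif f (m :: ins) m.+2 m.+3)))))) m
   (fun s => s m = 0 /\
     exists i a, star (loop_step Rel s) (s m, s m.+1) (i, a) /\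
      let s' := upd (upd s m i) m.+1 a in s' m = s' out /\
         verif_spec f (m :: ins) m.+2 (upd s' m.+2 0)).
  apply: (tests_loop Rloc _ _ loc1 (tests_Zer m m.+2) T1).
  - move=> s s' [_ /havocP[t ->] [u + [s1 h1 ->]]]; rewrite /= upd_eq updK => eu.
    rewrite {}eu in h1; have [cs a] := tf1 _ _ h1; set s2 := upd _ _ _ in cs a.
    have a' : agree m s s2 by apply: agree_upd.
    have [v ev] := tuple_map_size s sz.
    have e2m : s2 m = s m by rewrite /s2 upd_ne.
    split.
    + split; first by rewrite upd_ne 1?eq_sym // a // /s2 upd_ne.
      exists v => //; exists t; move: cs; rewrite (E _ v) ?(agree_map li a') // e2m.
      by rewrite /s2 upd_eq.
    + by rewrite upd_eq a ?e2m //; lia.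
    + exact: agree_trans a' (agree_trans (agree_le l2 a) (agree_upd _ _ (leqnn m))).
  - move=> s z [-> [v ev [t c]]].
    set s2 := upd s m.+2 t.+1.
    have a' : agree m s s2 by apply: agree_upd.
    have e2m : s2 m = s m by rewrite /s2 upd_ne.
    have [|s3 h3 a3] := tf2 s2.
      by apply/(E _ v); rewrite ?(agree_map li a') // e2m /s2 upd_eq.
    exists (upd s3 m (s3 m).+1); split.
    + exists (upd s m.+2 t); first by apply/havocP; eexists.
      exists s2; first by rewrite /= upd_eq updK.
      by exists s3.
    + by rewrite upd_ne 1?eq_sym // a3 // /s2 upd_ne.
    + by rewrite upd_eq a3 ?e2m //; lia.
    + exact: agree_trans a' (agree_trans (agree_le l2 a3) (agree_upd _ _ (leqnn m))).
apply: tests_ext (tests_ex (leqnn m) T) => s.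
have [v ev] := tuple_map_size s sz.
rewrite (verif_specE _ _ ev) /=.
pose R (p q : nat * nat) := [/\ q.1 = p.1.+1, q.2 = p.2 & exists t, computes f [tuple of p.1 :: v] t.+1].
have RelR s' (p q : nat * nat) : agree m s s' -> star (loop_step Rel s') p q <-> star R p q.
  move=> ag; split; apply: sub_star => x y.
    case=> e [e' [u eu c]]; split=> //.
    by rewrite (_ : v = u) //; apply: val_inj; rewrite /= eu ev (agree_map li ag).
  by case=> e e' c; split=> //; split=> //; exists v => //; rewrite (agree_map li ag).
have ag i : agree m s (upd s m i) by apply: agree_upd.
have finE i k a : (let s' := upd (upd (upd s m i) m k) m.+1 a in
    s' m = s' out /\ verif_spec f (m :: ins) m.+2 (upd s' m.+2 0))
    <-> k = s out /\ computes f [tuple of k :: v] 0.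
  rewrite /= [_ m]upd_ne // updK upd_eq [_ out]upd_ne; last by rewrite neq_ltn ltnW.
  rewrite upd_ne; last by rewrite neq_ltn lo.
  have em : upd (upd (upd s m k) m.+1 a) m.+2 0 m = k by rewrite upd_ne // upd_ne // upd_eq.
  by rewrite (E _ v) ?upd_eq ?em // !(map_upd_ge _ _ li).
split.
  case=> k0 []; rewrite upd_eq => -> [k [a [+ /finE[<- c]]]].
  rewrite RelR // => st; split=> //.
  have : forall p q, star R p q -> (forall z, z < p.1 -> exists t, computes f [tuple of z :: v] t.+1)
      -> forall z, z < q.1 -> exists t, computes f [tuple of z :: v] t.+1.
    move=> p q; elim=> // x y z _ IH [e _ r] h q' ; rewrite e ltnS leq_eqVlt.
    by case/orP=> [/eqP -> //|/IH]; apply.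
  by move=> h; apply: h st _.
case=> c h; exists 0; rewrite !upd_eq; split=> //.
exists (s out), (upd s m 0 m.+1); rewrite RelR //; split; last by apply/finE.
have : forall k, k <= s out -> star R (0, upd s m 0 m.+1) (k, upd s m 0 m.+1).
  elim=> [|k IH] lk; first exact: star_refl.
  by apply: star_step (IH (ltnW lk)) _; split=> //; apply: h.
exact.
Qed.

Theorem verifP n (f : prf n) : verif_ok f.
Proof.
elim: f => {n} [n||n i|k n f okf g okg|n f okf g okg|n f okf].
- move=> ins out m sz li lo no; apply: tests_ext (tests_Zer out m) => s.
  have [v ev] := tuple_map_size s sz.
  by rewrite (verif_specE _ _ ev).
- exact: verif_ok_Succ.
- move=> ins out m sz li lo no; have ini : nth 0 ins i \in ins by rewrite mem_nth // sz.
  apply: tests_ext (tests_eq _ lo _ (leqnn m)) => [s||].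
  + have [v ev] := tuple_map_size s sz.
    by rewrite (verif_specE _ _ ev) /= (tnth_nth 0) ev (nth_map 0) // sz.
  + by apply: contraNneq no => ->.
  + exact: (allP li).
- exact: verif_ok_Comp.
- exact: verif_ok_Prec.
- exact: verif_ok_Mu.
Qed.

Definition init_state (a : nat) : state := fun q => if q == 0 then a else 0.

Theorem re_prog (A : set nat) : recursively_enumerable A ->
  exists p, forall a, A a <-> exists s, sem p (init_state a) s.
Proof.
case=> f hf; exists (Seq (havoc 1) (verif f [:: 0] 1 2)) => a.
have T : tests (verif f [:: 0] 1 2) 1 (verif_spec f [:: 0] 1).
  by apply: (tests_weaken (leqnSn 1)); apply: verifP.
have [t1 t2] := tests_ex (leqnn 1) T.
have E y : verif_spec f [:: 0] 1 (upd (init_state a) 1 y) <-> computes f [tuple a] y.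
  by rewrite (@verif_specE _ f [:: 0] 1 _ [tuple a]) // upd_eq.
rewrite hf; split=> [[y c]|[s /t1[[y /E c] _]]]; last by exists y.
have [|s' h _] := t2 (init_state a); first by exists y; apply/E.
by exists s'.
Qed.

(** * Linear equations for the runs of an automaton *)

(* The linear equation
     \sum_f (ea f + eE f * (E - 1)) * x t f + \sum_f eb f * prev x t f
       + (t == 0) * (eg + ega * a) = er + erE * (E - 1). *)
Record eqn := Eqn { ea : nat -> nat; eE : nat -> nat; eb : nat -> nat;
  eg : nat; ega : nat; er : nat; erE : nat }.

Lemma nth_cons_all (T : Type) (d : T) (P : T -> Prop) (x : T) s :
  (forall k, k < size (x :: s) -> P (nth d (x :: s) k)) <->
  P x /\ forall k, k < size s -> P (nth d s k).
Proof.
split=> [h|[hx hs] [|k]] //=; last by rewrite ltnS; apply: hs.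
by split; [exact: (h 0) | move=> k; exact: (h k.+1)].
Qed.

Lemma nth_cat_all (T : Type) (d : T) (P : T -> Prop) s s' :
  (forall k, k < size (s ++ s') -> P (nth d (s ++ s') k)) <->
  (forall k, k < size s -> P (nth d s k)) /\ (forall k, k < size s' -> P (nth d s' k)).
Proof.
elim: s => [|x s IH] /=; first by split=> [|[]].
by rewrite -/(size (x :: _)) !nth_cons_all IH; tauto.
Qed.

Lemma nth_map_all (T : Type) (d : T) (P : T -> Prop) (g : nat -> T) n :
  (forall k, k < size (map g (iota 0 n)) -> P (nth d (map g (iota 0 n)) k)) <->
  forall i, i < n -> P (g i).
Proof.
rewrite size_map size_iota; split=> h i li.
  by have := h i li; rewrite (nth_map 0) ?size_iota // nth_iota.
by rewrite (nth_map 0) ?size_iota // nth_iota //; apply: h.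
Qed.

Definition reg (i : instr) := match i with Nop => 0 | Inc r | Dec r | Zer r => r end.
Definition is_inc r (i : instr) := if i is Inc q then q == r else false.
Definition is_dec r (i : instr) := if i is Dec q then q == r else false.
Definition is_zer r (i : instr) := if i is Zer q then q == r else false.

Lemma tmemP t c : tmem t c <-> exists2 j, j < size c & nth (0, Nop, 0) c j = t.
Proof.
elim: c => [|t' c IH] /=; first by split=> [|[]].
rewrite IH; split=> [[->|[j lj e]]|[[|j] lj e]]; first by exists 0.
- by exists j.+1.
- by left.
- by right; exists j.
Qed.

(** One strict bound serves for labels and registers alike, so label equations and register
    equations have the same index range. *)
Fixpoint bound (c : seq trans) : nat :=
  if c is t :: c' then (t.1.1 + reg t.1.2 + t.2 + bound c').+1 else 1.

Lemma boundP c j : j < size c -> let t := nth (0, Nop, 0) c j in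
  [/\ t.1.1 < bound c, reg t.1.2 < bound c & t.2 < bound c].
Proof.
elim: c j => [|t c IH] [|j] //= lj; first by split; lia.
by have /= [] := IH j lj; split; lia.
Qed.

Lemma bound_gt0 c : 0 < bound c. Proof. by case: c. Qed.

Lemma star_seq (T : Type) (rel : T -> T -> Prop) x y : star rel x y ->
  exists L (g : nat -> T), [/\ g 0 = x, g L = y & forall t, t < L -> rel (g t) (g t.+1)].
Proof.
elim=> [z|z z1 z2 _ [L [g [g0 gL gs]]] r]; first by exists 0, (fun=> z).
exists L.+1, (fun t => if t <= L then g t else z2); split=> //.
  by rewrite ltnn.
move=> t; rewrite ltnS leq_eqVlt => /orP[/eqP ->|lt].
  by rewrite eqxx ltnn gL.
by rewrite lt orbT; apply: gs.
Qed.

Section Machine.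
Variable c0 : seq trans.
(* The idle transition at the exit label lets an accepting run end on a row of its own. *)
Let c := (1, Nop, 1) :: c0.
Let m := size c.
Let rho := bound c.
Let tr j := nth (0, Nop, 0) c j.
Let src j := (tr j).1.1.
Let ins j := (tr j).1.2.
Let dst j := (tr j).2.
(* A row consists of m transition bits, followed for each register r by its value
   X r, the complement C r of that value to E - 1, and a slack S r used to express
   the zero tests. *)
Let X r := m + r.
Let C r := m + (rho + r).
Let S r := m + (rho + rho + r).
Definition nfields := m + (rho + rho + rho).
Let n := nfields.

Definition one_eq := Eqn (fun f => f < m) (fun=> 0) (fun=> 0) 0 0 1 0.
(* Since exactly one bit is set, the bits of the transitions not leaving q
   sum to 1 minus those leaving q. *)
Definition label_eq q := Eqn (fun f => (f < m) && (src f != q)) (fun=> 0)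
  (fun f => (f < m) && (dst f == q)) (q == 0) 0 1 0.
Definition compl_eq r := Eqn (fun f => (f == X r) + (f == C r)) (fun=> 0) (fun=> 0) 0 0 0 1.
(* old value + increment + (1 - decrement) + (E - 1 - new value) = E *)
Definition step_eq r := Eqn (fun f => f == C r) (fun=> 0)
  (fun f => (f == X r) + ((f < m) && is_inc r (ins f)) + ((f < m) && ~~ is_dec r (ins f)))
  1 (r == 0) 1 1.
(** If the row tests [r] for zero, the summand [E - 1] uses up the right side and forces [X r] to be
    0; otherwise the slack [S r] absorbs the difference. *)
Definition zero_eq r := Eqn (fun f => (f == X r) + (f == S r))
  (fun f => (f < m) && is_zer r (ins f)) (fun=> 0) 0 0 0 1.

Definition machine_eqs : seq eqn :=
  one_eq :: map label_eq (iota 0 rho) ++ map compl_eq (iota 0 rho) ++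
  map step_eq (iota 0 rho) ++ map zero_eq (iota 0 rho).

Definition field_bound E f := if f < m then 1 else E.-1.

Definition eqn_holds E a (x : nat -> nat -> nat) t (q : eqn) :=
  \sum_(f < n) (ea q f + eE q f * E.-1) * x t f + \sum_(f < n) eb q f * prev x t f
    + (t == 0) * (eg q + ega q * a) = er q + erE q * E.-1.

(** Field 0 is the bit of the idle transition at label 1, so the last clause says that row [T] has
    reached the exit. *)
Definition machine_sys E a T x :=
  [/\ forall t f, t <= T -> f < n -> x t f <= field_bound E f,
      forall k t, k < size machine_eqs -> t <= T -> eqn_holds E a x t (nth one_eq machine_eqs k)
    & odd (x T 0)].

Lemma machine_eqsP E a x t :
  (forall k, k < size machine_eqs -> eqn_holds E a x t (nth one_eq machine_eqs k)) <->
  [/\ eqn_holds E a x t one_eq,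
      forall q, q < rho -> eqn_holds E a x t (label_eq q),
      forall r, r < rho -> eqn_holds E a x t (compl_eq r),
      forall r, r < rho -> eqn_holds E a x t (step_eq r)
    & forall r, r < rho -> eqn_holds E a x t (zero_eq r)].
Proof.
by rewrite nth_cons_all !nth_cat_all !nth_map_all; split=> [[? [? [? []]]]|[]].
Qed.

Lemma sum_delta (y : nat -> nat) k : k < n -> \sum_(f < n) (f == k :> nat) * y f = y k.
Proof.
move=> lk; rewrite (bigD1 (Ordinal lk)) //= eqxx mul1n big1 ?addn0 // => i ne.
by rewrite (negbTE (_ : i != k :> nat)).
Qed.

Lemma sum_low (P : nat -> bool) (y : nat -> nat) :
  \sum_(f < n) ((f < m) && P f) * y f = \sum_(j < m) P j * y j.
Proof.
rewrite /n /nfields big_split_ord /= [X in _ + X]big1 ?addn0.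
  by apply: eq_bigr => i _; rewrite ltn_ord.
by move=> i _; rewrite ltnNge leq_addr.
Qed.

Lemma X_lt r : r < rho -> X r < n. Proof. by rewrite /X /n /nfields; lia. Qed.
Lemma C_lt r : r < rho -> C r < n. Proof. by rewrite /C /n /nfields; lia. Qed.
Lemma S_lt r : r < rho -> S r < n. Proof. by rewrite /S /n /nfields; lia. Qed.

Section Rows.
Variables (E a : nat) (x : nat -> nat -> nat) (t : nat).

Lemma one_eqE : eqn_holds E a x t one_eq <-> \sum_(j < m) x t j = 1.
Proof.
rewrite /eqn_holds /= !mul0n !addn0 muln0 addn0 [X in _ + X]big1 // addn0.
under eq_bigr => f _ do rewrite addn0 -[f < m]andbT.
rewrite (sum_low xpredT (x t)).
have -> // : \sum_(j < m) xpredT j * x t j = \sum_(j < m) x t j.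
by apply: eq_bigr => j _; exact: mul1n.
Qed.

Lemma label_eqE q : eqn_holds E a x t (label_eq q) <->
  \sum_(j < m) (src j != q) * x t j + \sum_(j < m) (dst j == q) * prev x t j
    + (t == 0) * (q == 0) = 1.
Proof.
rewrite /eqn_holds /= !mul0n !addn0.
under eq_bigr => f _ do rewrite addn0.
by rewrite (sum_low (fun f => src f != q)) (sum_low (fun f => dst f == q) (prev x t)).
Qed.

Lemma compl_eqE r : r < rho -> eqn_holds E a x t (compl_eq r) <->
  x t (X r) + x t (C r) = E.-1.
Proof.
move=> lr; rewrite /eqn_holds /= mul1n !mul0n !addn0 muln0 addn0 [X in _ + X]big1 // addn0.
under eq_bigr => f _ do rewrite addn0 mulnDl.
by rewrite big_split /= (sum_delta _ (X_lt lr)) (sum_delta _ (C_lt lr)).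
Qed.

Lemma step_eqE r : r < rho -> eqn_holds E a x t (step_eq r) <->
  x t (C r) + (prev x t (X r) + \sum_(j < m) is_inc r (ins j) * prev x t j
     + \sum_(j < m) ~~ is_dec r (ins j) * prev x t j)
    + (t == 0) * (1 + (r == 0) * a) = 1 + E.-1.
Proof.
move=> lr; rewrite /eqn_holds /= mul1n mul0n.
under eq_bigr => f _ do rewrite addn0.
under [X in _ + X + _]eq_bigr => f _ do rewrite !mulnDl.
rewrite !big_split /= (sum_delta _ (X_lt lr)) (sum_delta _ (C_lt lr)).
by rewrite (sum_low (fun f => is_inc r (ins f)) (prev x t))
  (sum_low (fun f => ~~ is_dec r (ins f)) (prev x t)).
Qed.

Lemma zero_eqE r : r < rho -> eqn_holds E a x t (zero_eq r) <->
  x t (X r) + x t (S r) + E.-1 * \sum_(j < m) is_zer r (ins j) * x t j = E.-1.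
Proof.
move=> lr; rewrite /eqn_holds /= mul1n !mul0n !addn0 muln0 addn0 [X in _ + X]big1 // addn0.
under eq_bigr => f _ do rewrite !mulnDl [_ * E.-1]mulnC -mulnA.
rewrite !big_split /= (sum_delta _ (X_lt lr)) (sum_delta _ (S_lt lr)) -big_distrr /=.
by rewrite (sum_low (fun f => is_zer r (ins f))).
Qed.

Lemma one_hot : \sum_(j < m) x t j = 1 ->
  exists2 j, j < m & forall P : nat -> bool, \sum_(i < m) P i * x t i = P j.
Proof.
move=> s1; have [j j1] : exists j : 'I_m, 0 < x t j.
  case: (pickP (fun j : 'I_m => 0 < x t j)) => [j h|h]; first by exists j.
  suff : \sum_(j < m) x t j = 0 by rewrite s1.
  by apply: big1 => i _; have := h i; rewrite lt0n => /negbFE/eqP.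
exists j => // P; move: s1; rewrite (bigD1 j) //= => s1; rewrite (bigD1 j) //=.
have z i : i != j -> x t i = 0.
  by move=> ne; move: s1 j1; rewrite (bigD1 i) //=; clear; lia.
rewrite big1 => [|i ne]; last by rewrite z ?muln0.
by have -> : x t j = 1 by [move: s1 j1; clear; lia]; rewrite muln1 addn0.
Qed.
End Rows.

(** Each row has exactly one transition bit set. The label equations make consecutive transitions
    fit together and the first one start at label 0, and the register equations make the values
    follow the instructions. *)
Lemma machine_sound E a T x : machine_sys E a T x ->
  exists y, star (cstep c) (0, init_state a) (1, y).
Proof.
case=> xb xe xT.
have {}xe t : t <= T -> _ := fun lt => proj1 (machine_eqsP E a x t) (fun k lk => xe k t lk lt).
have row t : t <= T -> exists2 j, j < m & forall P : nat -> bool, \sum_(i < m) P i * x t i = P j.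
  by move=> /xe[/one_eqE h _ _ _ _]; apply: one_hot h.
pose st t : state := fun r => if r < rho then x t (X r) else 0.
have run t : t <= T -> forall j, j < m ->
    (forall P : nat -> bool, \sum_(i < m) P i * x t i = P j) ->
    star (cstep c) (0, init_state a) (src j, st t).
  elim: t => [|t IH] lt j lj hj; have [_ hl hc hs hz] := xe _ lt.
    have [sj _ _] := boundP lj.
    have /label_eqE := hl _ sj; rewrite (hj (fun i => src i != src j)) eqxx /=.
    rewrite big1 => [|i _]; last by rewrite muln0.
    rewrite /src; case: eqP => // -> _.
    rewrite (_ : st 0 = init_state a); first exact: star_refl.
    apply: funext => r; rewrite /st /init_state; case: ifP => lr; last first.
      by case: eqP lr => // ->; rewrite bound_gt0.
    (* In row 0 the preceding row is zero; the constant [1 + (r == 0) * a] replaces the missing old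
       value and the missing non-decrement bit. *)
    have /compl_eqE := hc r lr; have /step_eqE := hs r lr; rewrite /= !big1 => [|i _|i _]; rewrite ?muln0 //.
    move=> /(_ lr) + /(_ lr); case: (r == 0); clear; lia.
  have [i li hi] := row t (ltnW lt).
  apply: star_step (IH (ltnW lt) i li hi) _.
  have [sj _ _] := boundP lj; have [_ ri _] := boundP li.
  have dsij : dst i = src j.
    have /label_eqE := hl _ sj; rewrite (hj (fun i => src i != src j)) eqxx /=.
    by rewrite (hi (fun k => dst k == src j)) addn0; case: eqP.
  exists (ins i).
    apply/tmemP; exists i => //=; rewrite -dsij /src /ins /dst /tr.
    by case: (nth _ _ _) => -[].
  (* The decrement stands on the left, so this relation also gives positivity of the old value at a
     [Dec]. *)
  have upd_st r : r < rho -> st t.+1 r + is_dec r (ins i) = st t r + is_inc r (ins i).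
    move=> lr; rewrite /st lr.
    have /compl_eqE := hc r lr; have /step_eqE := hs r lr.
    rewrite /= (hi (fun k => is_inc r (ins k))) (hi (fun k => ~~ is_dec r (ins k))).
    by move=> /(_ lr) + /(_ lr); case: (is_dec _ _); case: (is_inc _ _); clear; lia.
  have st0 u r : (r < rho) = false -> st u r = 0 by rewrite /st => ->.
  have zer_st r : r < rho -> is_zer r (ins i) -> st t r = 0.
    move=> lr z; have [_ _ _ _ hz'] := xe t (ltnW lt).
    have /zero_eqE := hz' r lr; rewrite (hi (fun k => is_zer r (ins k))) z muln1 => /(_ lr).
    by rewrite /st lr; clear; lia.
  have same : (forall r, is_dec r (ins i) = false) -> (forall r, is_inc r (ins i) = false) ->
      st t.+1 = st t.
    move=> nd ni; apply: funext => r; case lr: (r < rho); last by rewrite !st0.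
    by have := upd_st r lr; rewrite nd ni; clear; lia.
  rewrite /cstep /=; move: ri upd_st zer_st same; rewrite -/rho -/(tr i) -/(ins i).
  case: (ins i) => [|r|r|r] /= lr upd_st zer_st same.
  - exact: same.
  - apply: funext => q; rewrite /upd; case: eqP => [->|/eqP ne].
      by have := upd_st r lr; rewrite eqxx; clear; lia.
    case lq: (q < rho); last by rewrite !st0.
    by have := upd_st q lq; rewrite eq_sym (negbTE ne); clear; lia.
  - split; first by have := upd_st r lr; rewrite eqxx; clear; lia.
    apply: funext => q; rewrite /upd; case: eqP => [->|/eqP ne].
      by have := upd_st r lr; rewrite eqxx; clear; lia.
    case lq: (q < rho); last by rewrite !st0.
    by have := upd_st q lq; rewrite eq_sym (negbTE ne); clear; lia.
  - by split; [apply: zer_st | apply: same].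
have [j lj hj] := row T (leqnn T).
have := run T (leqnn T) j lj hj.
have -> : j = 0; last by exists (st T).
have m0 : 0 < m by [].
have := hj (fun i => i == 0); rewrite (bigD1 (Ordinal m0)) //= mul1n.
by case: eqP => // _ ; case: (x T 0) xT.
Qed.

(** A register grows by at most 1 per step, so all values are at most [a + T] and any larger [E]
    will do. [T] is fixed before [E], which lets [E] later be a power of 2 depending on [T]. *)
Lemma machine_complete a y : star (cstep c0) (0, init_state a) (1, y) ->
  exists T, forall E, a + T < E -> exists x, machine_sys E a T x.
Proof.
move=> run; have [T [g [g0 gT gs]]] := star_seq run; exists T => E lE.
(* Indices in [c] are one more than in [c0], the idle transition being first; row [T] takes the idle
   transition. The last disjunct makes the claim total in [t], as [choice] requires. *)
have hJ t : exists j, j < m /\ src j = (g t).1 /\ (t < T -> dst j = (g t.+1).1 /\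
    istep (ins j) (g t).2 (g t.+1).2) /\ (t = T -> j = 0) \/ T < t.
  case: (ltngtP t T) => [lt|lt|->].
  - have [i /tmemP[j lj ej] st] := gs t lt; exists j.+1; left.
    rewrite /src /dst /ins /tr /= ej; split; first by rewrite ltnS.
    by split=> //; split=> // e; rewrite e ltnn in lt.
  - by exists 0; right.
  - by exists 0; left; rewrite gT; do !split => //; rewrite ltnn.
have [J hJ'] := choice hJ.
have {hJ hJ'} PJ t : t <= T -> [/\ J t < m, src (J t) = (g t).1,
    t < T -> dst (J t) = (g t.+1).1 /\ istep (ins (J t)) (g t).2 (g t.+1).2
    & t = T -> J t = 0].
  by move=> lt; case: (hJ' t) => [[? [? []]]|]; [split | rewrite ltnNge lt].
have upd_st t r : t < T ->
    (g t.+1).2 r + is_dec r (ins (J t)) = (g t).2 r + is_inc r (ins (J t)).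
  move=> lt; have [_ _ /(_ lt)[_ st] _] := PJ t (ltnW lt).
  case: (ins (J t)) st => [|q|q|q] /=; rewrite ?addn0.
  - by move=> ->.
  - move=> ->; rewrite /upd [q == r]eq_sym; case: (r =P q) => [->|_]; by rewrite ?addn1 ?addn0.
  - move=> [l0 ->]; rewrite /upd [q == r]eq_sym; case: (r =P q) => [->|_]; last by rewrite addn0.
    by rewrite addn1 prednK.
  - by move=> [_ ->].
have le_st t r : t <= T -> (g t).2 r <= a + t.
  elim: t => [|t IH] lt; first by rewrite g0 /= /init_state; case: ifP; rewrite ?addn0.
  have := upd_st t r lt; have := IH (ltnW lt).
  by case: (is_inc _ _); case: (is_dec _ _); clear; lia.
have lt_st t r : t <= T -> (g t).2 r <= E.-1.
  by move=> lt; have := le_st t r lt; move: lE lt; clear; lia.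
have zer_st t r : t < T -> is_zer r (ins (J t)) -> (g t).2 r = 0.
  move=> lt; have [_ _ /(_ lt)[_ st] _] := PJ t (ltnW lt).
  by case: (ins (J t)) st => //= q [+ _] /eqP <-.
pose x t f := if f < m then (f == J t : nat)
  else if f < m + rho then (g t).2 (f - m)
  else if f < m + (rho + rho) then E.-1 - (g t).2 (f - m - rho)
  else if is_zer (f - m - rho - rho) (ins (J t)) then 0
  else E.-1 - (g t).2 (f - m - rho - rho).
have xl t j : j < m -> x t j = (j == J t) by rewrite /x => ->.
have xX t r : r < rho -> x t (X r) = (g t).2 r.
  by move=> lr; rewrite /x /X ltnNge leq_addr /= ltn_add2l lr addKn.
have xC t r : r < rho -> x t (C r) = E.-1 - (g t).2 r.
  move=> lr; rewrite /x /C ltnNge leq_addr /= ltn_add2l ltnNge leq_addr /= !ltn_add2l lr.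
  by rewrite !addKn.
have xS t r : r < rho -> x t (S r) = if is_zer r (ins (J t)) then 0 else E.-1 - (g t).2 r.
  move=> lr; rewrite /x /S ltnNge leq_addr /= ltn_add2l -addnA ltnNge leq_addr /=.
  by rewrite !ltn_add2l ltnNge leq_addr /= !addKn.
have one_row t (P : nat -> bool) : t <= T -> \sum_(i < m) P i * x t i = P (J t).
  move=> lt; have [lj _ _ _] := PJ t lt.
  rewrite (bigD1 (Ordinal lj)) //= xl // eqxx muln1 big1 ?addn0 // => i ne.
  by rewrite xl // (negbTE (_ : i != J t :> nat)) // muln0.
exists x; split.
- move=> t f lt lf; rewrite /field_bound /x; case: ifP => _; first exact: leq_b1.
  case: ifP => _; first exact: lt_st.
  by case: ifP => _; [exact: leq_subr | case: ifP => // _; exact: leq_subr].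
- move=> k t lk lt; move: k lk; apply/machine_eqsP.
  have [lj sj hj _] := PJ t lt; split.
  + apply/one_eqE; apply: etrans (one_row t xpredT lt).
    by apply: eq_bigr => i _; rewrite mul1n.
  + move=> q lq; apply/label_eqE; rewrite (one_row t (fun j => src j != q)) // sj.
    case: t lt sj hj lj => [|t] lt sj hj lj /=.
      rewrite big1 => [|i _]; last by rewrite muln0.
      by rewrite g0 /=; case: (q) => [|q'].
    rewrite (one_row t (fun j => dst j == q) (ltnW lt)) addn0.
    have [_ _ /(_ lt)[-> _] _] := PJ t (ltnW lt).
    by case: (_ == q).
  + by move=> r lr; apply/(compl_eqE _ _ _ _ lr); rewrite xX // xC // subnKC // lt_st.
  + move=> r lr; apply/(step_eqE _ _ _ _ lr); rewrite xC //.
    case: t lt sj hj lj => [|t] lt sj hj lj /=.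
      rewrite !big1 => [|i _|i _]; rewrite ?muln0 // g0 /= /init_state.
      by case: (r == 0); move: lE; clear; lia.
    rewrite xX // (one_row t (fun j => is_inc r (ins j)) (ltnW lt)).
    rewrite (one_row t (fun j => ~~ is_dec r (ins j)) (ltnW lt)).
    have := upd_st t r lt; have := lt_st t.+1 r lt; have := lE.
    by case: (is_inc _ _); case: (is_dec _ _); clear; lia.
  + move=> r lr; apply/(zero_eqE _ _ _ _ lr); rewrite xX // xS //.
    rewrite (one_row t (fun j => is_zer r (ins j)) lt).
    case: ifP => z; last by rewrite muln0 addn0 subnKC // lt_st.
    suff -> : (g t).2 r = 0 by rewrite muln1.
    have [_ _ _ jT] := PJ t lt; move: lt; rewrite leq_eqVlt => /orP[/eqP eT|lt].
      by move: z; rewrite jT.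
    exact: zer_st z.
- by rewrite xl //; have [_ _ _ ->] := PJ T (leqnn T).
Qed.

Lemma idle_star a y : star (cstep c) (0, init_state a) (1, y) ->
  star (cstep c0) (0, init_state a) (1, y).
Proof.
elim=> [z|u [q v] [q' w] _ IH [i /= [e|e] st]]; first exact: star_refl.
  by case: e st IH => -> -> -> /= ->.
by apply: star_step IH _; exists i.
Qed.
End Machine.

Theorem prog_machine p : exists c0, forall a,
  ((exists y, sem p (init_state a) y) <->
   exists T, forall E, a + T < E -> exists x, machine_sys c0 E a T x) /\
  forall E T x, machine_sys c0 E a T x -> exists y, sem p (init_state a) y.
Proof.
exists (compile p 0 1 2).1 => a.
have S E T x : machine_sys (compile p 0 1 2).1 E a T x -> exists y, sem p (init_state a) y.
  by move=> /machine_sound[y /idle_star h]; exists y; apply/compileP.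
split=> //; split=> [[y /compileP/machine_complete]//|[T h]].
by have [|x /S] := h (a + T).+1.
Qed.

(** * The exponential formula over the naturals *)

Fixpoint nat_eval n (rho : nat -> nat) (e : exp_expr n) : nat :=
  match e with
  | Var i => rho i
  | Const k => k
  | Add a b => nat_eval rho a + nat_eval rho b
  | Mul a b => nat_eval rho a * nat_eval rho b
  | Pow a b => nat_eval rho a ^ nat_eval rho b
  end.

Fixpoint vars_below n k (e : exp_expr n) : bool :=
  match e with
  | Var i => i < k
  | Const _ => true
  | Add a b | Mul a b | Pow a b => vars_below k a && vars_below k b
  end.

Section Expressible.
Variable n : nat.

(** Only variables 0 to 4 may occur, those that will be shown to take natural values. There are
    [n + 8] variables: [n = 0] gives the parameter with seven unknowns, [n = 1] the parameter with
    eight. *)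
Definition expressible (F : (nat -> nat) -> nat) :=
  exists2 e : exp_expr n.+4.+4, vars_below 5 e & forall rho, nat_eval rho e = F rho.

Lemma expressible_const c : expressible (fun=> c).
Proof. by exists (Const c). Qed.

Lemma expressible_var i : i < 5 -> expressible (fun rho => rho i).
Proof.
move=> li; have e : val (inord i : 'I_n.+4.+4) = i by rewrite /= inordK //; apply: leq_trans li _.
by exists (Var (inord i)) => [|rho] /=; rewrite e.
Qed.

Lemma expressible_add F G : expressible F -> expressible G -> expressible (fun rho => F rho + G rho).
Proof.
by move=> [a va ea] [b vb eb]; exists (Add a b) => [|rho] /=; rewrite ?va ?vb // ea eb.
Qed.

Lemma expressible_mul F G : expressible F -> expressible G -> expressible (fun rho => F rho * G rho).
Proof.
by move=> [a va ea] [b vb eb]; exists (Mul a b) => [|rho] /=; rewrite ?va ?vb // ea eb.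
Qed.

Lemma expressible_exp F G : expressible F -> expressible G -> expressible (fun rho => F rho ^ G rho).
Proof.
by move=> [a va ea] [b vb eb]; exists (Pow a b) => [|rho] /=; rewrite ?va ?vb // ea eb.
Qed.

Lemma expressible_sum (I : Type) (r : seq I) (F : I -> (nat -> nat) -> nat) :
  (forall i, expressible (F i)) -> expressible (fun rho => \sum_(i <- r) F i rho).
Proof.
move=> hF; elim: r => [|i r [e ve ee]].
  by exists (Const 0) => // rho; rewrite big_nil.
have [b vb eb] := hF i.
by exists (Add b e) => [|rho] /=; rewrite ?ve ?vb // big_cons /= ee eb.
Qed.

Lemma expressible_if (b : bool) F G : expressible F -> expressible G -> expressible (fun rho => if b then F rho else G rho).
Proof. by case: b. Qed.

Definition maskable (P : (nat -> nat) -> Prop) :=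
  exists R S, [/\ expressible R, expressible S & forall rho, P rho <-> mask (R rho) (S rho)].

Lemma maskable_mask R S : expressible R -> expressible S -> maskable (fun rho => mask (R rho) (S rho)).
Proof. by move=> hR hS; exists R, S. Qed.

(* Two masks are glued in base 2 ^ (R + S), which exceeds both R and S. *)
Lemma maskable_and P Q : maskable P -> maskable Q -> maskable (fun rho => P rho /\ Q rho).
Proof.
move=> [R [S [hR hS e]]] [R' [S' [hR' hS' e']]].
exists (fun rho => R rho + 2 ^ (R rho + S rho) * R' rho),
       (fun rho => S rho + 2 ^ (R rho + S rho) * S' rho).
split=> [||rho].
- by do !apply: expressible_add => //; apply: expressible_mul => //; apply: expressible_exp; [exact: expressible_const | exact: expressible_add].
- by do !apply: expressible_add => //; apply: expressible_mul => //; apply: expressible_exp; [exact: expressible_const | exact: expressible_add].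
rewrite mask_cat; first by rewrite e e'; split=> [[-> ->]|/andP].
  by apply: leq_ltn_trans (ltn_expl _ (ltnSn 1)); apply: leq_addr.
by apply: leq_ltn_trans (ltn_expl _ (ltnSn 1)); apply: leq_addl.
Qed.

Lemma maskable_all k P : (forall i, i < k -> maskable (P i)) ->
  maskable (fun rho => forall i, i < k -> P i rho).
Proof.
elim: k => [|k IH] h.
  exists (fun=> 0), (fun=> 0); split=> [||rho]; try exact: expressible_const.
  by rewrite mask0.
have [||R [S [hR hS e]]] := @maskable_and (P k) (fun rho => forall i, i < k -> P i rho).
- exact: h.
- by apply: IH => i li; apply: h; apply: ltnW.
exists R, S; split=> // rho; rewrite -e; split=> [H|[Hk H] i].
  by split=> [|i li]; apply: H => //; apply: ltnW.
by rewrite ltnS leq_eqVlt => /orP[/eqP ->|/H].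
Qed.
End Expressible.

Ltac express := repeat first
  [ apply: expressible_const | by apply: expressible_var | apply: expressible_add | apply: expressible_mul
  | apply: expressible_exp | (apply: expressible_sum => ?) | apply: expressible_if ].

(** Coarse bounds that do not depend on the machine. They keep the linear forms below [E ^ 3] and
    make the truncated subtractions in [machine_formula] exact. *)
Lemma machine_eqs_bound c0 k : k < size (machine_eqs c0) ->
  let q := nth (one_eq c0) (machine_eqs c0) k in
  [/\ forall f, ea q f + eE q f + eb q f <= 6, forall f, eE q f <= 1,
      eg q + ega q <= 2 & er q <= 1 /\ erE q <= 1].
Proof.
pose P q := [/\ forall f, ea q f + eE q f + eb q f <= 6, forall f, eE q f <= 1,
      eg q + ega q <= 2 & er q <= 1 /\ erE q <= 1].
move: k; change (forall k, k < size (machine_eqs c0) -> P (nth (one_eq c0) (machine_eqs c0) k)).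
rewrite nth_cons_all !nth_cat_all !nth_map_all /P /=.
do !split=> //= *; clear; lia.
Qed.

Section Formula.
Variables (n : nat) (c0 : seq trans).
Let eqs := machine_eqs c0.
Let nf := nfields c0.
(* Variables 0, ..., 4 stand for a, T, u, I, W; the field bound is E = u + 2. *)
Definition formula_base (rho : nat -> nat) := 2 * (rho 2 + 2) ^ 3.
Let D := formula_base.
Definition formula_eq k := nth (one_eq c0) eqs k.

(** These are the conditions of [run_masks] with [E = u + 2] expanded, as expressions have no
    subtraction: [E - 1 = u + 1], the base is [2 * E ^ 3], and [F.-1 = E ^ 3 - 1] becomes
    [u ^ 3 + 6 * u ^ 2 + 12 * u + 7]. Subtraction is left only between constants. *)
Definition machine_formula (rho : nat -> nat) :=
  [/\ mask (rho 4) (rho 3 *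
        \sum_(f < nf) (if f < (size c0).+1 then 1 else rho 2 + 1) * D rho ^ f),
      forall k, k < size eqs ->
        let q := formula_eq k in
        mask ((rho 2 ^ 3 + 6 * rho 2 ^ 2 + 12 * rho 2 + 7) * (D rho ^ nf * rho 3))
          (rho 4 * \sum_(f < nf) ((ea q f + eE q f * (rho 2 + 1)) * D rho ^ (nf - f)
                                  + eb q f * D rho ^ (nf + nf - f))
           + (rho 2 ^ 3 + 6 * rho 2 ^ 2 + (12 - erE q) * rho 2 + (7 - er q - erE q))
               * (D rho ^ nf * rho 3)
           + (eg q + ega q * rho 0) * D rho ^ nf)
    & mask (D rho ^ (nf * rho 1)) (rho 4)].

Lemma maskable_machine : maskable n machine_formula.
Proof.
have xD : expressible n D by rewrite /D /formula_base; express.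
have [R [S [hR hS e]]] : maskable n (fun rho =>
  (mask (rho 4) (rho 3 *
        \sum_(f < nf) (if f < (size c0).+1 then 1 else rho 2 + 1) * D rho ^ f) /\
   forall k, k < size eqs ->
        let q := formula_eq k in
        mask ((rho 2 ^ 3 + 6 * rho 2 ^ 2 + 12 * rho 2 + 7) * (D rho ^ nf * rho 3))
          (rho 4 * \sum_(f < nf) ((ea q f + eE q f * (rho 2 + 1)) * D rho ^ (nf - f)
                                  + eb q f * D rho ^ (nf + nf - f))
           + (rho 2 ^ 3 + 6 * rho 2 ^ 2 + (12 - erE q) * rho 2 + (7 - er q - erE q))
               * (D rho ^ nf * rho 3)
           + (eg q + ega q * rho 0) * D rho ^ nf))
    /\ mask (D rho ^ (nf * rho 1)) (rho 4)).
  apply: maskable_and; last by apply: maskable_mask; express.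
  apply: maskable_and; first by apply: maskable_mask; express.
  by apply: maskable_all => k _; apply: maskable_mask; express.
exists R, S; split=> // rho; rewrite -e /machine_formula.
by split=> [[]|[[]]].
Qed.

(** The exponent is chosen so that [E] exceeds [6 * nf + 3 + T + a], enough for the linear forms to
    stay below [E ^ 3]. *)
Lemma machine_formulaP a T E e : E = 2 ^ e -> e = T + (6 * nf + 2).+1 + a ->
  (exists x, machine_sys c0 E a T x) <->
  exists rho, [/\ rho 0 = a, rho 1 = T, rho 2 + 2 = 2 ^ (T + (6 * nf + 2).+1 + a),
    rho 3 * D rho ^ nf + 1 = (D rho ^ nf) ^ (T + 1) + rho 3 & machine_formula rho].
Proof.
move=> eE0 ee.
have E_gt : 6 * nf + 3 + T + a < E.
  by rewrite eE0; apply: leq_trans (ltn_expl e (ltnSn 1)); rewrite ee; lia.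
have nf0 : 0 < nf by rewrite /nf /nfields.
have bb f : field_bound c0 E f < 2 ^ e.
  by rewrite /field_bound -eE0; case: ifP => _; lia.
(* Both possible bounds, [1] and [2 ^ e - 1], are words of ones, below which the digitwise order is
   the usual one. *)
have bm f v : mask v (field_bound c0 E f) = (v <= field_bound c0 E f).
  rewrite /field_bound; case: ifP => _; first exact: (mask_ones 1).
  by rewrite eE0 mask_ones; have := expn_gt0 2 e; lia.
have E3 : 2 ^ (3 * e) = E ^ 3 by rewrite eE0 -expnM mulnC.
pose al k f := ea (formula_eq k) f + eE (formula_eq k) f * E.-1.
pose be k f := eb (formula_eq k) f.
pose ga k := eg (formula_eq k) + ega (formula_eq k) * a.
pose r k := er (formula_eq k) + erE (formula_eq k) * E.-1.
have ll k : k < size eqs -> (\sum_(f < nf) (al k f + be k f)) * 2 ^ e + ga k < 2 ^ (3 * e).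
  move=> lk; have [h1 h2 h3 _] := machine_eqs_bound lk.
  rewrite -/(formula_eq k) in h1 h2 h3.
  have l1 : \sum_(f < nf) (al k f + be k f) <= nf * (E + 5).
    rewrite -[nf in nf * _]card_ord -sum_nat_const; apply: leq_sum => f _; rewrite /al /be.
    by have := h1 f; have := h2 f; move: E_gt; case: (eE _ f) => [|[|?]] //; clear; lia.
  have l2 : ga k <= 2 + 2 * a.
    rewrite /ga; move: h3; clear; case: (ega _) => [|[|[|?]]]; lia.
  rewrite E3 -eE0; move: l1 l2 E_gt; clear.
  move: (\sum_(f < nf) _) => s l1 l2 lE; rewrite !expnS expn0 muln1; nia.
have rl k : k < size eqs -> r k < 2 ^ (3 * e).
  move=> lk; have [_ _ _ [h1 h2]] := machine_eqs_bound lk.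
  rewrite -/(formula_eq k) in h1 h2; rewrite E3 /r; move: h1 h2 E_gt; clear.
  by case: (erE _) => [|[|?]] // l1 _ lE; rewrite !expnS expn0 muln1; nia.
have P I := @packP nf (size eqs) e T 0 _ al be ga r nf0 bb bm ll rl I.
have S x : machine_sys c0 E a T x <->
  run_sys nf (size eqs) T 0 (field_bound c0 E) al be ga r x by [].
have M rho : rho 0 = a -> rho 1 = T -> rho 2 + 2 = E -> machine_formula rho <->
    run_masks nf (size eqs) e T 0 (field_bound c0 E) al be ga r (rho 3) (rho 4).
  move=> r0 r1 r2.
  have DE k : D rho ^ k = 2 ^ ((3 * e).+1 * k).
    by rewrite expnM /D /formula_base (expnS 2 (3 * e)) E3 r2.
  have u1 : E.-1 = rho 2 + 1 by rewrite -r2 addn2 addn1.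
  have F1 : (2 ^ (3 * e)).-1 = rho 2 ^ 3 + 6 * rho 2 ^ 2 + 12 * rho 2 + 7.
    by rewrite E3 -r2 !expnS expn0 !muln1; clear; nia.
  have Fr k : k < size eqs -> rho 2 ^ 3 + 6 * rho 2 ^ 2 + 12 * rho 2 + 7 - r k =
      rho 2 ^ 3 + 6 * rho 2 ^ 2 + (12 - erE (formula_eq k)) * rho 2
      + (7 - er (formula_eq k) - erE (formula_eq k)).
    move=> lk; have [_ _ _ []] := machine_eqs_bound lk; rewrite -/(formula_eq k) /r u1.
    case: (er _) => [|[|?]] //; case: (erE _) => [|[|?]] // _ _; clear; lia.
  rewrite /machine_formula /run_masks addn0 !DE r1 F1.
  have -> : \sum_(f < nf) (if f < (size c0).+1 then 1 else rho 2 + 1) * D rho ^ f =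
      \sum_(f < nf) field_bound c0 E f * 2 ^ ((3 * e).+1 * f).
    by apply: eq_bigr => f _; rewrite DE /field_bound u1.
  have C k : \sum_(f < nf) ((ea (formula_eq k) f + eE (formula_eq k) f * (rho 2 + 1)) *
         D rho ^ (nf - f) + eb (formula_eq k) f * D rho ^ (nf + nf - f)) =
      coef_word nf e al be k.
    by apply: eq_bigr => f _; rewrite !DE /al /be u1.
  split=> -[ha hb hc]; split=> // k lk; have := hb k lk; rewrite /= C Fr // /ga r0 //.
have nf_step : 2 ^ ((3 * e).+1 * nf) = (2 * E ^ 3) ^ nf by rewrite expnM (expnS 2 (3 * e)) E3.
split=> [[x /S hx]|[rho [r0 r1 r2 rI /M]]]; last first.
  move=> /(_ r0 r1); rewrite r2 -ee -eE0 => /(_ erefl) h.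
  have [|_ []] := P (rho 3); first by move: rI; rewrite /D /formula_base r2 -ee -eE0 !addn1 nf_step.
    by exists (rho 4).
  by move=> x /S hx; exists x.
have [I hI] := geom_exists (2 ^ ((3 * e).+1 * nf)) T.
have [W hW] := proj1 (P I hI) (ex_intro _ x hx).
pose rho i := nth 0 [:: a; T; E - 2; I; W] i.
have r2 : rho 2 + 2 = E by rewrite /rho /= subnK //; move: E_gt; clear; lia.
exists rho; split=> //.
- by rewrite r2 eE0 ee.
- rewrite -[rho 3]/I /D /formula_base r2 -nf_step hI.
  by rewrite [T + 1]addn1.
- by apply/M.
Qed.
End Formula.

Theorem re_formula n (A : set nat) : recursively_enumerable A ->
  exists k N R S, [/\ 0 < k, expressible n R, expressible n S & forall a, A a <->
    exists rho, [/\ rho 0 = a, rho 2 + 2 = 2 ^ (rho 1 + N.+1 + a),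
      rho 3 * formula_base rho ^ k + 1 = (formula_base rho ^ k) ^ (rho 1 + 1) + rho 3
      & mask (R rho) (S rho)]].
Proof.
case/re_prog=> p hp; have [c0 hc] := prog_machine p.
have [R [S [hR hS e]]] := maskable_machine n c0.
exists (nfields c0), (6 * nfields c0 + 2), R, S; split=> // a.
have [h1 h2] := hc a; rewrite hp; split.
  move=> /h1[T hT].
  have [|x hx] := hT (2 ^ (T + (6 * nfields c0 + 2).+1 + a)).
    by apply: leq_trans (ltn_expl _ (ltnSn 1)); clear; lia.
  have [|rho [r0 r1 r2 rI f]] := proj1 (@machine_formulaP c0 a T _ _ erefl erefl); first by exists x.
  by exists rho; rewrite r1; split=> //; apply/e.
case=> rho [r0 r2 rI /e f].
have [|x /h2] := proj2 (@machine_formulaP c0 a (rho 1) _ _ erefl erefl); last by [].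
by exists rho.
Qed.

(** * From natural to rational unknowns *)

(** The division drops the lower digits, and the base is even, so digit [R] alone decides the
    parity. *)
Lemma odd_digit d P w R : 0 < d -> (forall p, w p < 2 ^ d) -> R < P ->
  odd (num d P w %/ 2 ^ (d * R)) = odd (w R).
Proof.
move=> d0; have D0 := expn_gt0 2 d.
have oD q : odd (2 ^ d * q) = false by rewrite oddM oddX; case: (d) d0.
elim: R P w => [|R IH] [|P] w wlt //= lR.
  by rewrite muln0 divn1 numS oddD oD addbF.
rewrite mulnS expnD divnMA.
have -> : num d P.+1 w %/ 2 ^ d = num d P (w \o S).
  by rewrite numS addnC mulnC divnMDl // divn_small // addn0.
by rewrite IH // => p; apply: wlt.
Qed.

(** Every binomial coefficient of row [S] is at most [2 ^ S], hence below [U]: the row is the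
    sequence of digits of [(1 + U) ^ S] in base [U]. *)
Lemma mask_div R S : let U := 2 ^ S.+1 in
  mask R S = odd ((1 + U) ^ S %/ U ^ R).
Proof.
move=> U.
have blt p : 'C(S, p) < 2 ^ S.+1.
  have -> : 2 ^ S.+1 = (1 + 1) ^ S * 2 by rewrite expnS mulnC.
  rewrite expnDn; case: (leqP p S) => [le|lt]; last first.
    rewrite bin_small // muln_gt0 andbT big_ord_recl.
    by rewrite addn_gt0 !exp1n bin0.
  rewrite muln2 -addnn (bigD1 (Ordinal (le : p < S.+1))) //= !exp1n !muln1.
  by have : 0 < 'C(S, p) by [rewrite bin_gt0]; lia.
(* The word is padded with zeros so that digit [R] exists also for [R > S]. *)
have -> : (1 + U) ^ S = num S.+1 (R + S).+1 (fun p => 'C(S, p)).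
  rewrite -(@num_le S.+1 (R + S).+1 S.+1) => [||p lt]; last 1 first.
  - exact: bin_small.
  - rewrite expnDn; apply: eq_bigr => i _.
    by rewrite exp1n mul1n /U -expnM.
  - by rewrite ltnS leq_addl.
by rewrite /U -expnM odd_digit // ltnS leq_addr.
Qed.

Section RationalUnknowns.
Local Open Scope ring_scope.

(** For rational [z >= 0] the fraction [z / (1 + z)] runs through the rationals in [[0, 1)], so the
    equation, with denominators cleared, says that the integer part of the quotient is
    [2 * h + 1]. *)
Lemma mask_rat R S : mask R S <-> exists h (z : rat), 0 <= z /\
  ((1 + 2 ^ S.+1) ^ S)%N%:R * (1 + z) =
  ((2 * h + 1)%N%:R * (1 + z) + z) * ((2 ^ S.+1) ^ R)%N%:R.
Proof.
rewrite mask_div; set N := ((1 + _) ^ _)%N; set V := ((_ ^ _) ^ R)%N.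
have V0 : (0 < V)%N by rewrite /V !expn_gt0.
have VR : 0 < V%:R :> rat by rewrite ltr0n.
split=> [od|[h [z [z0 e]]]].
  (* This choice of [z] makes [z / (1 + z)] equal to the fractional part [(N %% V) / V]. *)
  exists (N %/ V)./2, ((N %% V)%:R / (V - N %% V)%:R).
  have lm := ltn_pmod N V0.
  have q0 : 0 < (V - N %% V)%:R :> rat by rewrite ltr0n subn_gt0.
  split; first by rewrite divr_ge0 ?ler0n ?ltW.
  have -> : (2 * (N %/ V)./2 + 1 = N %/ V)%N.
    by rewrite -{2}(odd_double_half (N %/ V)) od mul2n addnC.
  have -> : N%:R = (N %/ V)%:R * V%:R + (N %% V)%:R :> rat.
    by rewrite -natrM -natrD -divn_eq.
  have -> : (V - N %% V)%:R = V%:R - (N %% V)%:R :> rat by rewrite natrB // ltnW.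
  have nz : V%:R - (N %% V)%:R != 0 :> rat by rewrite -natrB ?lt0r_neq0 // ltnW.
  by field.
pose y := z / (1 + z).
have z1 : 0 < 1 + z by rewrite ltr_wpDr.
have y0 : 0 <= y by rewrite divr_ge0 // ltW.
have y1 : y < 1 by rewrite ltr_pdivrMr // mul1r ltrDr.
have e' : N%:R = ((2 * h + 1)%:R + y) * V%:R.
  apply: (mulIf (lt0r_neq0 z1)); rewrite e /y; field.
  by rewrite lt0r_neq0.
have -> : (N %/ V = 2 * h + 1)%N; last by rewrite oddD oddM.
apply/eqP; rewrite eqn_leq -ltnS ltn_divLR // leq_divRL //.
rewrite -(ltr_nat rat) -(ler_nat rat) !natrM e'; apply/andP; split.
  by rewrite ltr_pM2r // -natr1 ltrD2l.
by rewrite ler_pM2r // lerDl.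
Qed.

Lemma nat_ratio (x : rat) : 0 <= x -> exists a b : nat, (0 < b)%N /\ x = a%:R / b%:R.
Proof.
move=> x0; exists `|numq x|%N, `|denq x|%N; split; first by rewrite absz_gt0 denq_neq0.
rewrite -{1}(divq_num_den x); congr (_ / _).
  by rewrite -[numq x in LHS]gez0_abs ?numq_ge0.
by rewrite -[denq x in LHS]gez0_abs // denq_ge0.
Qed.

Section Real.
Variable R : realType.

Lemma powR_ratio (b : nat) (x : rat) p d : (0 < b)%N -> (0 < d)%N -> x = p%:R / d%:R ->
  ((b%:R : R) `^ ratr x) ^+ d = (b ^ p)%N%:R.
Proof.
move=> b0 d0 ->; rewrite -powR_mulrn ?powR_ge0 // -powRrM.
rewrite fmorph_div !rmorph_nat mulfVK ?pnatr_eq0 -?lt0n //.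
by rewrite powR_mulrn ?ler0n // natrX.
Qed.

(** Bring both exponents to the denominator [b * d] and raise to that power. Comparing the
    multiplicities of the primes 2 and 3 in the resulting identity of naturals shows that [b * d]
    divides both numerators. *)
Lemma pow_rational_nat (x y w : rat) : 0 <= x -> 0 <= y ->
  (2%:R : R) `^ ratr x * 3%:R `^ ratr y = ratr w -> exists p q : nat, x = p%:R /\ y = q%:R.
Proof.
move=> x0 y0 e.
have [a [b [b0 ex]]] := nat_ratio x0; have [c [d [d0 ey]]] := nat_ratio y0.
have w0 : 0 < w.
  by rewrite -(ltr0q R) -e mulr_gt0 // powR_gt0 // ltr0n.
have [s [t [t0 ew]]] := nat_ratio (ltW w0).
have bd0 : (0 < b * d)%N by rewrite muln_gt0 b0.
have nz k : (0 < k)%N -> k%:R != 0 :> rat by rewrite pnatr_eq0 lt0n.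
have ex' : x = (a * d)%N%:R / (b * d)%N%:R.
  by rewrite ex !natrM; field; rewrite !nz.
have ey' : y = (c * b)%N%:R / (b * d)%N%:R.
  by rewrite ey !natrM; field; rewrite !nz.
have key : (2 ^ (a * d) * 3 ^ (c * b) * t ^ (b * d) = s ^ (b * d))%N.
  apply/eqP; rewrite -(eqr_nat R) !natrM -(powR_ratio _ bd0 ex') // -(powR_ratio _ bd0 ey') //.
  rewrite -exprMn e ew fmorph_div !rmorph_nat !natrX -exprMn mulfVK //.
  by rewrite pnatr_eq0 -lt0n.
have s0 : (0 < s)%N.
  by rewrite -(ltr0n rat); move: w0; rewrite ew pmulr_lgt0 // invr_gt0 ltr0n.
have dv p k : prime p -> (k + (b * d) * logn p t = (b * d) * logn p s)%N -> (b * d %| k)%N.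
  move=> _ ek; have : (b * d %| k + b * d * logn p t)%N by rewrite ek dvdn_mulr.
  by rewrite dvdn_addl // dvdn_mulr.
have lg p : prime p -> (logn p (2 ^ (a * d)) + logn p (3 ^ (c * b))
    + (b * d) * logn p t = (b * d) * logn p s)%N.
  by move=> pp; rewrite -!lognX -!lognM ?muln_gt0 ?expn_gt0 ?t0 // key.
have l22 : logn 2 2 = 1%N by [].
have l33 : logn 3 3 = 1%N by [].
have l23 : logn 2 3 = 0%N by [].
have l32 : logn 3 2 = 0%N by [].
have := lg 2 isT; have := lg 3 isT; rewrite !lognX l22 l33 l23 l32 !muln1 !muln0 addn0 add0n.
move=> /(dv 3 _ isT)/dvdnP[q eq] /(dv 2 _ isT)/dvdnP[p ep].
exists p, q; split.
  by rewrite ex' ep natrM mulfK // nz.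
by rewrite ey' eq natrM mulfK // nz.
Qed.

Lemma nonneg_admissible n (x : n.-tuple rat) (e : exp_expr n) :
  (forall i, 0 <= tnth x i) -> exp_admissible R x e /\ 0 <= exp_eval R x e.
Proof.
move=> x0; elim: e => [i|k|a [a1 a2] b [b1 b2]|a [a1 a2] b [b1 b2]|a [a1 a2] b [b1 b2]] /=.
- by rewrite ler0q.
- by rewrite ler0n.
- by rewrite a1 b1 addr_ge0.
- by rewrite a1 b1 mulr_ge0.
- by rewrite a1 b1 a2 b2 powR_ge0.
Qed.

Lemma eval_nat n (x : n.-tuple rat) (rho : nat -> nat) k (e : exp_expr n) : vars_below k e ->
  (forall i : 'I_n, (i < k)%N -> tnth x i = (rho i)%:R) ->
  exp_admissible R x e /\ exp_eval R x e = (nat_eval rho e)%:R.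
Proof.
move=> + hx; elim: e => [i|j|a IHa b IHb|a IHa b IHb|a IHa b IHb] /=.
- by move=> /hx ->; rewrite ratr_nat.
- by [].
- by case/andP=> /IHa[-> ->] /IHb[-> ->]; rewrite natrD.
- by case/andP=> /IHa[-> ->] /IHb[-> ->]; rewrite natrM.
- by case/andP=> /IHa[-> ->] /IHb[-> ->]; rewrite !ler0n powR_mulrn ?ler0n // natrX.
Qed.

(** A sum of squares of differences equated to 0, with the mixed products moved to the right because
    expressions have no subtraction. *)
Definition system n (s : seq (exp_equation n)) : exp_equation n :=
  (foldr (fun E e => Add (Add (Mul E.1 E.1) (Mul E.2 E.2)) e) (Const 0) s,
   foldr (fun E e => Add (Mul (Const 2) (Mul E.1 E.2)) e) (Const 0) s).

Lemma systemP n (x : n.-tuple rat) s :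
  is_solution R x (system s) <-> foldr (fun E P => is_solution R x E /\ P) True s.
Proof.
(* Nonnegativity of the difference joins the induction, so that a vanishing sum splits into
   vanishing summands. *)
have [d0] : 0 <= exp_eval R x (system s).1 - exp_eval R x (system s).2 /\
  (is_solution R x (system s) <-> foldr (fun E P => is_solution R x E /\ P) True s); last by [].
elim: s => [|E s [d0 IH]] /=; first by split; rewrite ?subrr //; split=> // _; split; rewrite //= subrr.
have ev : exp_eval R x (system (E :: s)).1 - exp_eval R x (system (E :: s)).2 =
   (exp_eval R x E.1 - exp_eval R x E.2) ^+ 2
   + (exp_eval R x (system s).1 - exp_eval R x (system s).2).
  by rewrite /=; ring.
split; first by rewrite ev addr_ge0 ?sqr_ge0.
rewrite -IH; split=> [[a1 a2 e]|[[a1 a2 e] [b1 b2 e']]].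
  move: a1 a2 => /= /andP[/andP[/andP[a1 _] /andP[a2 _]] b1] /andP[_ b2].
  have sq0 := sqr_ge0 (exp_eval R x E.1 - exp_eval R x E.2).
  move/eqP: e; rewrite ev paddr_eq0 // sqrf_eq0 => /andP[/eqP e /eqP e'].
  by split; split.
split.
- by move: b1 => /= ->; rewrite a1 a2.
- by move: b2 => /= ->; rewrite a1 a2.
- by rewrite ev e e' expr0n addr0.
Qed.

End Real.

Section Equation.
Variable R : realType.
Variables (n k N : nat) (eR eS : exp_expr n.+4.+4).
(* Variables 5, 6, 7 stand for h, z, w. *)
Let V i : exp_expr n.+4.+4 := Var (inord i).
Let C j : exp_expr n.+4.+4 := Const j.
Let B := Pow (Mul (C 2) (Pow (Add (V 2) (C 2)) (C 3))) (C k).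
Let U := Pow (C 2) (Add eS (C 1)).

(** The power is split into factors so that variable 1 is an exponent by itself and admissibility
    makes it nonnegative. *)
Definition eq_width :=
  (Add (V 2) (C 2), Mul (Mul (Pow (C 2) (V 1)) (C (2 ^ N.+1)%N)) (Pow (C 2) (V 0))).
Definition eq_geom := (Add (Mul (V 3) B) (C 1), Add (Pow B (Add (V 1) (C 1))) (V 3)).
Definition eq_nat := (Mul (Pow (C 2) (V 4)) (Pow (C 3) (V 5)), V 7).
(* The exponent 1 makes admissibility enforce that variable 6 is nonnegative. *)
Definition eq_mask :=
  (Mul (Pow (Add (C 1) U) eS) (Add (C 1) (Pow (V 6) (C 1))),
   Mul (Add (Mul (Add (Mul (C 2) (V 5)) (C 1)) (Add (C 1) (V 6))) (V 6)) (Pow U eR)).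
Definition re_system := [:: eq_width; eq_geom; eq_nat; eq_mask].

Hypothesis k_gt0 : (0 < k)%N.
Variables Rf Sf : (nat -> nat) -> nat.
Hypotheses (vR : vars_below 5 eR) (vS : vars_below 5 eS).
Hypotheses (hR : forall rho, nat_eval rho eR = Rf rho) (hS : forall rho, nat_eval rho eS = Sf rho).

Section Point.
Variables (X : n.+4.+4.-tuple rat) (rho : nat -> nat) (h : nat) (z : rat).
Let x i := tnth X (inord i).
Hypothesis xrho : forall i, (i < 5)%N -> x i = (rho i)%:R.
Hypothesis x5 : x 5 = h%:R.
Hypothesis x6 : x 6 = z.
Hypothesis z0 : 0 <= z.

Lemma xrho_ord (i : 'I_n.+4.+4) : (i < 5)%N -> tnth X i = (rho i)%:R.
Proof. by move=> li; rewrite -xrho // /x inord_val. Qed.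

Lemma eval_point (e : exp_expr n.+4.+4) : vars_below 5 e ->
  exp_eval R X e = (nat_eval rho e)%:R.
Proof. by move=> ve; have [_] := eval_nat R ve xrho_ord. Qed.

Lemma VE i : exp_eval R X (V i) = ratr (x i). Proof. by []. Qed.

Lemma width_point : exp_eval R X eq_width.1 = exp_eval R X eq_width.2 <->
  (rho 2 + 2 = 2 ^ (rho 1 + N.+1 + rho 0))%N.
Proof.
rewrite !eval_point /= ?inordK //.
split=> [/eqP|->]; first by rewrite eqr_nat !expnD => /eqP.
by rewrite !expnD.
Qed.

Lemma geom_point : exp_eval R X eq_geom.1 = exp_eval R X eq_geom.2 <->
  (rho 3 * formula_base rho ^ k + 1 = (formula_base rho ^ k) ^ (rho 1 + 1) + rho 3)%N.
Proof.
rewrite !eval_point /= ?inordK // /formula_base.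
by split=> [/eqP|->//]; rewrite eqr_nat => /eqP.
Qed.

Lemma mask_point : exp_eval R X eq_mask.1 = exp_eval R X eq_mask.2 <->
  ((1 + 2 ^ (Sf rho).+1) ^ Sf rho)%N%:R * (1 + z) =
  ((2 * h + 1)%N%:R * (1 + z) + z) * ((2 ^ (Sf rho).+1) ^ Rf rho)%N%:R.
Proof.
have EU e : vars_below 5 e -> exp_eval R X (Pow U e) = ((2 ^ (Sf rho).+1) ^ nat_eval rho e)%N%:R.
  by move=> ve; rewrite eval_point /= ?vS ?ve // hS addn1.
have E1 : exp_eval R X (Pow (Add (C 1) U) eS) = ((1 + 2 ^ (Sf rho).+1) ^ Sf rho)%N%:R.
  by rewrite eval_point /= ?vS // hS addn1.
have -> : exp_eval R X eq_mask.1 =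
    ratr (((1 + 2 ^ (Sf rho).+1) ^ Sf rho)%N%:R * (1 + z)).
  rewrite -[LHS]/(exp_eval R X (Pow (Add (C 1) U) eS) *
     (1 + exp_eval R X (V 6) `^ 1)) E1 VE x6 powRr1 ?ler0q //.
  by rewrite rmorphM rmorphD rmorph1 rmorph_nat.
have -> : exp_eval R X eq_mask.2 =
    ratr (((2 * h + 1)%N%:R * (1 + z) + z) * ((2 ^ (Sf rho).+1) ^ Rf rho)%N%:R).
  rewrite -[LHS]/(((2%:R * exp_eval R X (V 5) + 1) * (1 + exp_eval R X (V 6))
     + exp_eval R X (V 6)) * exp_eval R X (Pow U eR)) EU // hR !VE x5 x6.
  rewrite [(2 * h + 1)%N%:R]natrD natrM.
  by rewrite !(rmorphM, rmorphD, rmorph_nat, rmorph1).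
split=> [|-> //]; exact: fmorph_inj.
Qed.
End Point.

(** Natural values give a nonnegative point, where every expression is admissible. Conversely,
    admissibility yields the signs; [eq_nat] makes [W] and [h] natural, [eq_width] then makes [T]
    and [u] natural, and [eq_geom] determines [I]. *)
Lemma re_systemP a : 
  (exists rho, [/\ rho 0 = a, rho 2 + 2 = 2 ^ (rho 1 + N.+1 + a),
      rho 3 * formula_base rho ^ k + 1 = (formula_base rho ^ k) ^ (rho 1 + 1) + rho 3
      & mask (Rf rho) (Sf rho)])%N <->
  exists x : n.+4.+3.-tuple rat, is_solution R [tuple of a%:R :: x] (system re_system).
Proof.
split=> [[rho [r0 r2 r3 /mask_rat[h [z [z0 hz]]]]]|].
  pose l : seq rat := [:: (rho 1)%:R; (rho 2)%:R; (rho 3)%:R; (rho 4)%:R; h%:R; z;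
                (2 ^ rho 4 * 3 ^ h)%N%:R].
  (* Coordinates beyond the seven listed ones get the default value 0. *)
  exists [tuple l`_i | i < n.+4.+3].
  set X := [tuple of _ :: _].
  have Xn i : (i < n.+4.+4)%N -> tnth X (inord i) = nth 0 (a%:R :: l) i.
    move=> li; rewrite (tnth_nth 0) inordK //; case: i li => [|i] //= li.
    have li' : (i < n.+4.+3)%N by [].
    by rewrite (nth_map (Ordinal li')) ?size_enum_ord // nth_enum_ord.
  have xrho i : (i < 5)%N -> tnth X (inord i) = (rho i)%:R.
    move=> li; rewrite Xn; last by apply: leq_trans li _.
    by case: i li => [|[|[|[|[|i]]]]] //= _; rewrite r0.
  have x5 : tnth X (inord 5) = h%:R by rewrite Xn.
  have x6 : tnth X (inord 6) = z by rewrite Xn.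
  have x7 : tnth X (inord 7) = (2 ^ rho 4 * 3 ^ h)%N%:R by rewrite Xn.
  have X0 i : 0 <= tnth X i.
    rewrite -[i]inord_val Xn //.
    by case: (i : nat) => [|[|[|[|[|[|[|[|q]]]]]]]] /=; rewrite ?ler0n // nth_nil.
  have sol (E : exp_equation n.+4.+4) : exp_eval R X E.1 = exp_eval R X E.2 -> is_solution R X E.
    by move=> e; split; rewrite ?e ?subrr //; apply: (nonneg_admissible _ _ X0).1.
  apply/systemP; split; [|split; [|split; [|split=> //]]]; apply: sol.
  - by apply/(width_point xrho); rewrite r0.
  - exact/(geom_point xrho).
  - rewrite /= x7 x5 xrho // !ratr_nat !powR_mulrn ?ler0n //.
    by rewrite natrM !natrX.
  - exact/(mask_point xrho x5 x6 z0).
case=> x; set X := [tuple of _ :: x] => /systemP[w [g [m [b _]]]].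
pose y i := tnth X (inord i).
have y0 : y 0%N = a%:R by rewrite /y (tnth_nth 0) inordK.
have T0 : 0 <= y 1%N.
  by case: w => _ /= /andP[/andP[/andP[_ t0] _] _] _; rewrite -(ler0q R).
have [W0 h0] : 0 <= y 4%N /\ 0 <= y 5%N.
  case: m => /= /andP[/andP[_ p] /andP[_ q]] _ _.
  by rewrite -!(ler0q R).
have z0 : 0 <= y 6%N.
  case: b => /= /andP[_ /andP[t0 _]] _ _.
  by rewrite -(ler0q R).
case: w => _ _ /eqP; rewrite subr_eq0 => /eqP ew.
case: g => _ _ /eqP; rewrite subr_eq0 => /eqP eg.
case: m => _ _ /eqP; rewrite subr_eq0 => /eqP em.
case: b => _ _ /eqP; rewrite subr_eq0 => /eqP eb.
have [h1 [h2 [eh1 eh2]]] := pow_rational_nat W0 h0 em.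
have ew' : (ratr (y 2%N) : R) + 2%:R = 2%:R `^ ratr (y 1%N) * (2 ^ N.+1 * 2 ^ a)%N%:R.
  rewrite -[LHS]/(exp_eval R X eq_width.1) ew /= -/(y 0%N) y0 ratr_nat powR_mulrn ?ler0n //.
  by rewrite natrM !natrX mulrA.
have c0 : (0 < 2 ^ N.+1 * 2 ^ a)%N by rewrite muln_gt0 !expn_gt0.
(* The lemma on [2 ^ x * 3 ^ y] is applied with second exponent 0. *)
have [t [_ [eT _]]] : exists p q : nat, y 1%N = p%:R /\ 0 = q%:R :> rat.
  apply: (@pow_rational_nat R _ _ ((y 2%N + 2%:R) / (2 ^ N.+1 * 2 ^ a)%N%:R)) => //.
  by rewrite rmorph0 powRr0 mulr1 fmorph_div rmorphD !rmorph_nat ew' mulfK // pnatr_eq0 -lt0n.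
have eu : y 2%N + 2%:R = (2 ^ (t + N.+1 + a))%N%:R.
  apply: (@fmorph_inj _ R ratr); rewrite rmorphD !rmorph_nat ew' eT ratr_nat.
  by rewrite powR_mulrn ?ler0n // -natrX -natrM mulnA -!expnD.
(* The summand [N.+1] keeps the exponent positive, so the natural subtraction defining [u] is
   exact. *)
have u2 : (2 <= 2 ^ (t + N.+1 + a))%N.
  by rewrite -{1}(expn1 2) leq_exp2l //; lia.
pose u := (2 ^ (t + N.+1 + a) - 2)%N.
have yu : y 2%N = u%:R by rewrite /u natrB // -eu addrK.
pose D := ((2 * (u + 2) ^ 3) ^ k)%N.
have EB : exp_eval R X B = D%:R.
  rewrite /= -/(y 2%N) yu ratr_nat /D !natrX natrM natrX natrD.
  by rewrite !powR_mulrn ?mulr_ge0 ?exprn_ge0 ?addr_ge0 ?ler0n.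
have [I hI] := geom_exists D t.
have D1 : (1 < D)%N.
  by rewrite /D -(exp1n k) ltn_exp2r //; clear; lia.
(* Both numbers solve the same linear equation with coefficient [D - 1], which is nonzero. *)
have yI : y 3%N = I%:R.
  suff h : (ratr (y 3%N) : R) = I%:R.
    by apply: (@fmorph_inj _ R ratr); rewrite rmorph_nat -h.
  have DR : (D%:R - 1 : R) != 0 by rewrite subr_eq0 pnatr_eq1 neq_ltn D1 orbT.
  apply: (mulIf DR).
  have hI' : (I%:R * D%:R + 1 : R) = D%:R ^+ t.+1 + I%:R.
    by have := congr1 (fun q => q%:R : R) hI; rewrite !natrD natrM natrX.
  have : (ratr (y 3%N) * D%:R + 1 : R) = D%:R ^+ t.+1 + ratr (y 3%N).
    rewrite -EB -[LHS]/(exp_eval R X eq_geom.1) eg.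
    rewrite -[LHS]/(exp_eval R X B `^ (ratr (y 1%N) + 1%:R) + ratr (y 3%N)) eT ratr_nat.
    by rewrite -natrD addn1 EB powR_mulrn ?ler0n.
  by move: hI'; lra.
pose rho i := nth 0%N [:: a; t; u; I; h1] i.
have xrho i : (i < 5)%N -> y i = (rho i)%:R.
  by case: i => [|[|[|[|[|i]]]]].
exists rho; split=> //.
- exact: subnK.
- exact/(geom_point xrho).
apply/mask_rat; exists h2, (y 6%N); split=> //.
exact/(mask_point xrho eh2 erefl z0).
Qed.

End Equation.

Theorem re_equation (R : realType) n (A : set nat) : recursively_enumerable A ->
  exists E : exp_equation n.+4.+4, forall a : nat,
    A a <-> exists x : n.+4.+3.-tuple rat, is_solution R [tuple of a%:R :: x] E.
Proof.
case/(re_formula n)=> k [N [Rf [Sf [k0 [eR vR hR] [eS vS hS] hA]]]].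
exists (system (re_system k N eR eS)) => a.
rewrite hA; exact: (re_systemP R N k0 vR vS hR hS a).
Qed.

End RationalUnknowns.

(** * Undecidability *)

(** For [Mu], the smaller of two distinct values would be a place where [f] is both 0 and
    positive. *)
Lemma computes_fun n (f : prf n) v y y' : computes f v y -> computes f v y' -> y = y'.
Proof.
elim: f v y y' => {n} [n||n i|k n f IHf g IHg|n f IHf g IHg|n f IHf] v y y' /=.
- by move=> -> ->.
- by move=> -> ->.
- by move=> -> ->.
- case=> w [hw c] [w' [hw' c']]; apply: IHf c _.
  suff -> : w = w' by [].
  by apply: eq_from_tnth => i; apply: IHg (hw i) (hw' i).
- elim: (thead v) y y' => [|k IH] y y'; first exact: IHf.
  by move=> [z [hz c]] [z' [hz' c']]; rewrite (IH _ _ hz' hz) in c'; apply: IHg c c'.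
- case=> c h [c' h']; case: (ltngtP y y') => // [/h'|/h] [t ct].
    by have := IHf _ _ _ c ct.
  by have := IHf _ _ _ c' ct.
Qed.

(** * Closure properties of total computable functions *)

Definition computable n (F : n.-tuple nat -> nat) :=
  exists f : prf n, forall v y, computes f v y <-> y = F v.

Lemma computable_ext n (F G : n.-tuple nat -> nat) :
  (forall v, F v = G v) -> computable F -> computable G.
Proof. by move=> e [f hf]; exists f => v y; rewrite hf e. Qed.

Lemma computable_proj n (i : 'I_n) : computable (fun v => tnth v i).
Proof. by exists (Proj i). Qed.

Lemma computable_comp k n (F : k.-tuple nat -> nat) (G : 'I_k -> n.-tuple nat -> nat) :
  computable F -> (forall i, computable (G i)) ->
  computable (fun v => F [tuple G i v | i < k]).
Proof.
move=> [f hf] /choice[g hg]; exists (Comp f g) => v y /=; split.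
  case=> w [hw /hf ->]; congr F; apply: eq_from_tnth => i.
  by rewrite tnth_mktuple; apply/hg.
move=> ->; exists [tuple G i v | i < k]; split; last exact/hf.
by move=> i; rewrite tnth_mktuple; apply/hg.
Qed.

Definition computable1 (F : nat -> nat) := computable (fun v : 1.-tuple nat => F (tnth v ord0)).
Definition computable2 (F : nat -> nat -> nat) :=
  computable (fun v : 2.-tuple nat => F (tnth v ord0) (tnth v ord_max)).

Lemma computable_app1 n F (G : n.-tuple nat -> nat) :
  computable1 F -> computable G -> computable (fun v => F (G v)).
Proof.
move=> hF hG; apply: computable_ext (computable_comp hF (fun=> hG)) => v.
by rewrite tnth_mktuple.
Qed.

Lemma computable_app2 n F (G H : n.-tuple nat -> nat) :
  computable2 F -> computable G -> computable H -> computable (fun v => F (G v) (H v)).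
Proof.
move=> hF hG hH.
have h (i : 'I_2) : computable (if i == ord0 then G else H) by case: eqP.
by apply: computable_ext (computable_comp hF h) => v; rewrite !tnth_mktuple.
Qed.

Lemma computable_succ : computable1 succn.
Proof. by exists Succ. Qed.

Lemma computable_const n c : computable (fun _ : n.-tuple nat => c).
Proof.
elim: c => [|c IH]; first by exists (Zero n).
exact: computable_app1 computable_succ IH.
Qed.

Lemma computable_rec n (F : n.-tuple nat -> nat) (G : n.+2.-tuple nat -> nat)
  (H : nat -> n.-tuple nat -> nat) : computable F -> computable G ->
  (forall u, H 0 u = F u) -> (forall k u, H k.+1 u = G [tuple of k :: H k u :: u]) ->
  computable (fun v => H (thead v) (behead_tuple v)).
Proof.
move=> [f hf] [g hg] H0 HS; exists (Prec f g) => v y /=.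
elim: (thead v) y => [|k IH] y; first by rewrite hf H0.
split=> [[z [/IH -> /hg ->]]|->]; first by rewrite HS.
by exists (H k (behead_tuple v)); rewrite IH hg HS.
Qed.

Lemma computable_mu n (F : n.+1.-tuple nat -> nat) (G : n.-tuple nat -> nat) :
  computable F ->
  (forall v, F [tuple of G v :: v] = 0 /\ forall z, z < G v -> F [tuple of z :: v] != 0) ->
  computable G.
Proof.
move=> [f hf] hG; exists (Mu f) => v y /=; have [G0 Gz] := hG v; split.
  case=> /hf/esym c h; case: (ltngtP y (G v)) => // [/Gz|/h[t /hf]]; first by rewrite c.
  by rewrite G0.
move=> ->; split=> [|z /Gz nz]; first by apply/hf; rewrite G0.
by exists (F [tuple of z :: v]).-1; apply/hf; rewrite prednK // lt0n.
Qed.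

Lemma computable_rec1 c (G : nat -> nat -> nat) (H : nat -> nat) :
  computable2 G -> H 0 = c -> (forall k, H k.+1 = G k (H k)) -> computable1 H.
Proof.
move=> hG H0 HS.
apply: computable_ext (@computable_rec 0 (fun=> c) _ (fun k _ => H k)
  (computable_const _ _) hG (fun=> H0) _) => [v|k u] //.
Qed.

Lemma computable_rec2 (F : nat -> nat) (G : nat -> nat -> nat) (H : nat -> nat -> nat) :
  computable1 F -> computable2 G -> (forall y, H 0 y = F y) ->
  (forall k y, H k.+1 y = G (H k y) y) -> computable2 H.
Proof.
move=> hF hG H0 HS.
(* In the triple formed by counter, accumulator and parameter, places 1 and 2 are the accumulator
   and the parameter. *)
have hG' : computable (fun v : 3.-tuple nat => G (tnth v (inord 1)) (tnth v (inord 2))).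
  exact: computable_app2 hG (computable_proj _) (computable_proj _).
apply: computable_ext (@computable_rec 1 _ _ (fun k u => H k (tnth u ord0)) hF hG' _ _).
- by move=> v; congr H; rewrite !(tnth_nth 0) nth_behead.
- by move=> u; rewrite H0.
- by move=> k u; rewrite HS; congr G; rewrite !(tnth_nth 0) !inordK.
Qed.

Lemma computable_swap F : computable2 F -> computable2 (fun x y => F y x).
Proof. by move=> hF; exact: computable_app2 hF (computable_proj _) (computable_proj _). Qed.

Lemma computable_id : computable1 id.
Proof. exact: computable_proj. Qed.

Lemma computable_add : computable2 addn.
Proof.
apply: (computable_rec2 (G := fun z _ => z.+1) computable_id) => //.
exact: computable_app1 computable_succ (computable_proj _).
Qed.

Lemma computable_pred : computable1 predn.
Proof. by apply: (computable_rec1 (G := fun k _ => k)) => //; apply: computable_proj. Qed.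

Lemma computable_sub : computable2 subn.
Proof.
apply: (computable_swap (F := fun k m => m - k)).
apply: (computable_rec2 (G := fun z _ => z.-1) computable_id); try by move=> *; lia.
exact: computable_app1 computable_pred (computable_proj _).
Qed.

(** * Computability of the Cantor pairing and its inverse *)

Definition triangle s := (s * s.+1)./2.

Lemma triangleS s : triangle s.+1 = triangle s + s.+1.
Proof.
rewrite /triangle; have -> : s.+1 * s.+2 = s * s.+1 + s.+1.*2 by rewrite -mul2n; lia.
by rewrite halfD oddM odd_double andbF add0n doubleK.
Qed.

Lemma computable_triangle : computable1 triangle.
Proof.
apply: (@computable_rec1 0 (fun k z => z + k.+1)) => //; last exact: triangleS.
apply: computable_app2 computable_add (computable_proj _) _.
exact: computable_app1 computable_succ (computable_proj _).
Qed.

Lemma computable_pair : computable2 cantor_pair.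
Proof.
have P i := @computable_proj 2 i.
exact: computable_app2 computable_add
  (computable_app1 computable_triangle (computable_app2 computable_add (P ord0) (P ord_max)))
  (P ord_max).
Qed.

Lemma triangle_unbounded n : exists s, n < triangle s.+1.
Proof. by exists n; rewrite triangleS; lia. Qed.

(** The sum [a + b] of the pair coded by [n]: codes on the diagonal of sum [s] fill the interval
    from [triangle s] to [triangle s.+1], the latter excluded. *)
Definition diagonal n := ex_minn (triangle_unbounded n).
Definition unpair2 n := n - triangle (diagonal n).
Definition unpair1 n := diagonal n - unpair2 n.

Lemma diagonal_pair a b : diagonal (cantor_pair a b) = a + b.
Proof.
rewrite /diagonal /cantor_pair -/(triangle (a + b)); case: ex_minnP => s hs hmin.
have mono i j : i <= j -> triangle i <= triangle j.
  by move=> le; apply: half_leq; apply: leq_mul.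
apply/eqP; rewrite eqn_leq hmin; last by rewrite triangleS; lia.
by rewrite leqNgt; apply/negP => /mono; lia.
Qed.

Lemma unpair2_pair a b : unpair2 (cantor_pair a b) = b.
Proof. by rewrite /unpair2 diagonal_pair addKn. Qed.

Lemma unpair1_pair a b : unpair1 (cantor_pair a b) = a.
Proof. by rewrite /unpair1 unpair2_pair diagonal_pair addnK. Qed.

Lemma computable_diagonal : computable1 diagonal.
Proof.
have P i := @computable_proj 2 i.
apply: (@computable_mu 1 (fun v => (tnth v ord_max).+1 - triangle (tnth v ord0).+1)).
  apply: computable_app2 computable_sub (computable_app1 computable_succ (P ord_max)) _.
  exact: computable_app1 computable_triangle (computable_app1 computable_succ (P ord0)).
move=> v; rewrite !(tnth_nth 0) /= /diagonal; set m := nth 0 v 0.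
case: ex_minnP => s hs hmin; split; first by apply/eqP; rewrite subn_eq0.
move=> z lz; rewrite !(tnth_nth 0) /= -/m subn_eq0; apply/negP => /hmin; lia.
Qed.

Lemma computable_unpair2 : computable1 unpair2.
Proof.
apply: computable_app2 computable_sub computable_id _.
exact: computable_app1 computable_triangle computable_diagonal.
Qed.

Lemma computable_unpair1 : computable1 unpair1.
Proof. exact: computable_app2 computable_sub computable_diagonal computable_unpair2. Qed.

(** The parameter is fixed by an additional equation instead of a substitution, which leaves the
    expressions of [E] intact inside the new code. *)
Definition instance n (E : exp_equation n.+1) (a : nat) : exp_equation n.+1 :=
  system [:: E; (Var ord0, Const a)].

(** The expansion of [system] on two equations, carried out on codes: [v] and [k] code the two sides
    of the added equation, and [z] codes the [Const 0] that ends each sum. *)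
Definition self_instance c :=
  let e1 := unpair1 c in let e2 := unpair2 c in
  let add x y := cantor_pair 2 (cantor_pair x y) in
  let mul x y := cantor_pair 3 (cantor_pair x y) in
  let v := cantor_pair 0 0 in let k := cantor_pair 1 c in
  let z := cantor_pair 1 0 in let two := cantor_pair 1 2 in
  cantor_pair (add (add (mul e1 e1) (mul e2 e2)) (add (add (mul v v) (mul k k)) z))
              (add (mul two (mul e1 e2)) (add (mul two (mul v k)) z)).

Lemma self_instanceE n (E : exp_equation n.+1) :
  self_instance (code_equation E) = code_equation (instance E (code_equation E)).
Proof. by rewrite /self_instance unpair1_pair unpair2_pair. Qed.

Lemma computable_self_instance : computable1 self_instance.
Proof.
rewrite /computable1 /self_instance.
do ![exact: computable_const | exact: computable_unpair1 | exact: computable_unpair2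
  | exact: computable_id | apply: (computable_app2 computable_pair)].
Qed.

Lemma instanceP (R : realType) n (E : exp_equation n.+1) a :
  solvable_over_rat R (instance E a) <->
  exists x : n.-tuple rat, is_solution R [tuple of (a%:R)%R :: x] E.
Proof.
split=> [[X /systemP[s [[_ _ /= /eqP]]]]|[x s]].
  rewrite subr_eq0 -(ratr_nat R) => /eqP/fmorph_inj e _; exists (behead_tuple X).
  rewrite (_ : [tuple of _] = X) //; apply: val_inj => /=.
  by rewrite -e; case/tupleP: X {s e} => y X; rewrite tnth0.
exists [tuple of (a%:R)%R :: x]; apply/systemP; split=> //; split=> //; split=> //=.
by rewrite tnth0 ratr_nat subrr.
Qed.

(** Let [D] be the set of [c] for which the alleged procedure answers 0 on [self_instance c]. It is
    recursively enumerable, hence given by some [E]; for [c] the code of [E], the instance of [E] at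
    [c] is solvable exactly when the procedure declares it unsolvable. *)
Theorem undecidable (R : realType) :
  ~ (exists f : prf 1, forall E : exp_equation 8,
       (solvable_over_rat R E -> computes f [tuple code_equation E] 1) /\
       (~ solvable_over_rat R E -> computes f [tuple code_equation E] 0)).
Proof.
case=> f hf; have [q hq] := computable_self_instance.
(* The value of [h] does not depend on its first argument, so [Mu h] is defined exactly where that
   value is 0, provided the value exists: the answer 0 becomes a domain of definition. *)
pose h := Comp f (fun _ : 'I_1 => Comp q (fun _ : 'I_1 => Proj (ord_max : 'I_2))).
have hh y c z : computes h [tuple y; c] z <-> computes f [tuple self_instance c] z.
  have inner t : (exists w : 1.-tuple nat, (forall i : 'I_1, tnth w i = c) /\ computes q w t)
      <-> t = self_instance c.
    split=> [[w [hw /hq ->]]|->]; first by rewrite hw.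
    by exists [tuple c]; split=> [i|]; [rewrite ord1 | apply/hq].
  split=> [[w [hw cf]]|cf].
    rewrite (_ : [tuple _] = w) //; apply: eq_from_tnth => i.
    by rewrite ord1 -((inner _).1 (hw ord0)).
  by exists [tuple self_instance c]; split=> // i; rewrite ord1; apply/inner.
pose D c := exists y, computes (Mu h) [tuple c] y.
have DE c : D c <-> computes f [tuple self_instance c] 0.
  split=> [[y [/hh]]//|c0]; exists 0; split; last by [].
  exact/hh.
(* With [n = 0] the parameter and the seven unknowns are together the eight variables of [E]. *)
have [|E hE] := @re_equation R 0 D; first by exists (Mu h).
have e := self_instanceE E; set c := code_equation E in e.
have [s1 s0] := hf (instance E c).
have key : solvable_over_rat R (instance E c) <-> D c by rewrite instanceP hE.
case: (pselect (solvable_over_rat R (instance E c))) => s.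
  by have := computes_fun (s1 s); rewrite -e => /(_ 0 (proj1 (DE c) (proj1 key s))).
by apply: (s); apply/key/DE; rewrite e; apply: s0.
Qed.

Theorem theorem1p1 (R : realType) :
  (forall A : set nat, recursively_enumerable A ->
     exists E : exp_equation 9, forall a : nat,
       A a <-> exists x : 8.-tuple rat,
                 is_solution R [tuple of (a%:R)%R :: x] E) /\
  ~ (exists f : prf 1, forall E : exp_equation 8,
       (solvable_over_rat R E -> computes f [tuple code_equation E] 1) /\
       (~ solvable_over_rat R E -> computes f [tuple code_equation E] 0)).
Proof.
split=> [A hA|]; last exact: undecidable.
(* With [n = 1] the parameter is followed by eight unknowns. *)
exact: (@re_equation R 1 A hA).
Qed.
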